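(* Let $f\colon\mathbb{D}\to\mathbb{D}$ be a hyperbolic map with Denjoy--Wolff point $\tau\in\partial\mathbb{D}$. For any $z,w\in\mathbb{D}$, the sequence $\{d_{\mathbb{D}}(w,f^n(z))\}$ is eventually strictly increasing.
   Context: $\mathbb{D}$ is the open unit disc of $\mathbb{C}$. Its hyperbolic metric is $d_{\mathbb{D}}(z,w)=\inf_{\sigma}\int_{\sigma}\frac{|d\zeta|}{1-|\zeta|^2}$, the infimum being over all piecewise $C^1$-smooth curves $\sigma$ in $\mathbb{D}$ joining $z$ to $w$. $f^n$ denotes the $n$-th iterate $f\circ\cdots\circ f$ ($n$ times). If $f\colon\mathbb{D}\to\mathbb{D}$ is holomorphic without fixed points in $\mathbb{D}$, the Denjoy--Wolff Theorem gives a unique point $\tau\in\partial\mathbb{D}$, the Denjoy--Wolff point of $f$, such that $f^n$ converges to the constant $\tau$ uniformly on compact subsets of $\mathbb{D}$; moreover the angular derivative $f'(\tau)$ (the non-tangential limit of $\frac{f(z)-\tau}{z-\tau}$ as $z\to\tau$) exists and lies in $(0,1]$. The map $f$ is called hyperbolic if it is holomorphic, has no fixed points in $\mathbb{D}$, and $f'(\tau)<1$. A sequence is eventually strictly increasing if there is an index from which on it is strictly increasing. *)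

(* Defs.v *)
From Stdlib Require Import Reals List.
From Coquelicot Require Import Coquelicot.

Set Implicit Arguments.

Open Scope R_scope.

Definition unit_disc (z : C) : Prop := Cmod z < 1.

(** [gamma] is C^1 on the closed interval [a, b]; the filters [within] make the
    derivatives at the two endpoints one-sided. *)
Definition C1_on (gamma : R -> C) (a b : R) : Prop :=
  exists gamma' : R -> C,
    (forall t : R, a <= t <= b ->
       filterdiff (K := R_AbsRing) (U := R_NormedModule) (V := C_R_NormedModule)
         gamma (within (fun s => a <= s <= b) (locally t))
         (fun h => scal h (gamma' t : C_R_NormedModule))) /\
    continuous_on (fun s => a <= s <= b) gamma'.

(** Consecutive pieces share the value of [gamma] at their common endpoint, so a
    piecewise C^1 curve is continuous on [a, b]. *)
Definition piecewise_C1 (gamma : R -> C) (a b : R) : Prop :=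
  exists (k : nat) (t : nat -> R),
    t 0%nat = a /\ t (S k) = b /\
    (forall i : nat, (i <= k)%nat ->
       t i < t (S i) /\ C1_on gamma (t i) (t (S i))).

(** [Derive] is total; for a piecewise C^1 curve on [a, b], [velocity] can take
    unspecified values only at the finitely many partition points, which do not
    affect integrals. *)
Definition velocity (gamma : R -> C) (t : R) : C :=
  (Derive (fun s => Re (gamma s)) t, Derive (fun s => Im (gamma s)) t).

Definition hyperbolic_length (gamma : R -> C) (a b L : R) : Prop :=
  is_RInt (fun t => Cmod (velocity gamma t) / (1 - Cmod (gamma t) ^ 2)) a b L.

Definition joining_length (z w : C) (L : R) : Prop :=
  exists (a b : R) (gamma : R -> C),
    a < b /\ piecewise_C1 gamma a b /\
    (forall t : R, a <= t <= b -> unit_disc (gamma t)) /\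
    gamma a = z /\ gamma b = w /\
    hyperbolic_length gamma a b L.

(** For [z] and [w] in the disc the set of lengths is nonempty and bounded below
    by 0, so its infimum in [Rbar] is finite. *)
Definition hyperbolic_dist (z w : C) : R :=
  real (Glb_Rbar (joining_length z w)).

Definition holomorphic_self_map (f : C -> C) : Prop :=
  forall z : C, unit_disc z ->
    unit_disc (f z) /\ ex_derive (K := C_AbsRing) (V := C_NormedModule) f z.

Definition iterate (f : C -> C) (n : nat) (z : C) : C := Nat.iter n f z.

Definition compact_set (K : C -> Prop) : Prop :=
  forall F : (C -> Prop) -> Prop,
    (forall U, F U -> open U) ->
    (forall z, K z -> exists U, F U /\ U z) ->
    exists l : list (C -> Prop),
      (forall U, In U l -> F U) /\
      (forall z, K z -> exists U, In U l /\ U z).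

Definition denjoy_wolff_point (f : C -> C) (tau : C) : Prop :=
  Cmod tau = 1 /\
  forall K : C -> Prop, compact_set K -> (forall z, K z -> unit_disc z) ->
    forall eps : R, 0 < eps ->
      exists N : nat, forall n : nat, (N <= n)%nat ->
        forall z : C, K z -> Cmod (iterate f n z - tau) < eps.

Definition stolz_region (tau : C) (M : R) (z : C) : Prop :=
  unit_disc z /\ Cmod (z - tau) < M * (1 - Cmod z).

Definition nontangential_limit (g : C -> C) (tau l : C) : Prop :=
  forall M : R, 1 < M ->
    filterlim g (within (stolz_region tau M) (locally tau)) (locally l).

Definition angular_derivative (f : C -> C) (tau l : C) : Prop :=
  nontangential_limit (fun z => ((f z - tau) / (z - tau))%C) tau l.

Definition hyperbolic_map (f : C -> C) : Prop :=
  holomorphic_self_map f /\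
  (forall z : C, unit_disc z -> f z <> z) /\
  exists (tau : C) (a : R),
    denjoy_wolff_point f tau /\ angular_derivative f tau (RtoC a) /\ a < 1.

Definition eventually_strictly_increasing (u : nat -> R) : Prop :=
  exists N : nat, forall m n : nat, (N <= m)%nat -> (m < n)%nat -> u m < u n.

(* Main.v *)
Require Import Defs.
From Stdlib Require Import Reals Lra Lia ClassicalEpsilon.
From Coquelicot Require Import Coquelicot.

(** Let [z_n] be the orbit of [z], [sigma] the boundary point at which [f] has
    the angular derivative [a < 1], and
    [P z = (1 - |z|^2) / |z - sigma|^2] the Poisson kernel of the disc at
    [sigma].

    - The distance from [w] to [v] is an increasing function of
      [Q(v,w) = |1 - conj w v|^2 / ((1 - |v|^2) (1 - |w|^2))], because it is
      [artanh |phi v|] for the disc automorphism [phi] sending [w] to 0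
      ([hyperbolic_dist_artanh]). So the claim concerns the numbers
      [Q(z_n,w)].
    - Julia's lemma ([julia_lemma]) is the limit of the Schwarz-Pick inequality
      along the radius ending at [sigma]. It gives [P z_n <= b P z_(n+1)] for
      some [b < 1], so that [P z_n] grows geometrically and [z_n] tends to
      [sigma] ([orbit_converges]).
    - By Schwarz-Pick the steps of the orbit are bounded: [Q(z_(n+1),z_n)] is
      at most [Q(z_1,z_0)]. In the coordinate [1 / (z - sigma)] such a step has
      length at most a constant times [P z_(n+1)]; summing the geometric
      growth, [1 / |z_n - sigma|] is at most a constant times [P z_n]. This
      says that [z_n] tends to [sigma] inside a Stolz region
      ([orbit_nontangential]).
    - Hence [(z_(n+1) - sigma) / (z_n - sigma)] tends to [a], and the gap
      [1 - |z_n|^2] shrinks at each step by a factor eventually below a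
      constant smaller than 1 ([gap_contraction]). In [Q(z_n,w)] the numerator
      converges to the positive number [|1 - conj w sigma|^2], and the
      denominator is this gap times a constant, so [Q(z_n,w)] eventually
      increases ([point_pair_eventually_increasing]).

    The function theory rests on complex differentiability alone, without
    continuity of the derivative. Goursat's subdivision argument shows that a
    differentiable divergence-free planar field has no flux through the
    boundary of a rectangle ([flux_zero]). For [g] composed with the
    exponential on a rectangle of height [2 pi] the horizontal sides cancel by
    periodicity, so the mean of [g] over a circle around 0 does not depend on
    the radius ([circle_mean]). Recentering by disc automorphisms turns this
    into a maximum principle, whence the Schwarz lemma and the Schwarz-Pick
    inequality ([schwarz_pick]). *)

(** * The divergence theorem without continuous derivatives *)

(** The divergence is [a + (- a)]. Both components are differentiable as
    functions of two variables at the point [(x, y)]; nothing is said about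
    neighbouring points. *)
Definition divergence_free_at (U V : R -> R -> R) (x y : R) : Prop :=
  exists a b c : R,
    differentiable_pt_lim U x y a b /\ differentiable_pt_lim V x y c (- a).

(** Outward flux of the field [(U, V)] through the boundary of the rectangle
    with lower left corner [(x, y)], width [w] and height [h]. *)
Definition flux (U V : R -> R -> R) (x y w h : R) : R :=
  RInt (fun t => U (x + w) t - U x t) y (y + h) +
  RInt (fun s => V s (y + h) - V s y) x (x + w).

Lemma RInt_near_const (f : R -> R) (a b k M : R) :
  a <= b -> ex_RInt f a b -> (forall t, a <= t <= b -> Rabs (f t - k) <= M) ->
  Rabs (RInt f a b - k * (b - a)) <= (b - a) * M.
Proof.
  intros Hab Hf HM.
  replace (RInt f a b - k * (b - a)) with (RInt (fun t => f t - k) a b).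
  - apply abs_RInt_le_const; [exact Hab | | exact HM].
    apply (ex_RInt_minus (V := R_NormedModule) f (fun _ => k)); [exact Hf | apply ex_RInt_const].
  - rewrite (RInt_minus f (fun _ => k)); [| exact Hf | apply ex_RInt_const].
    rewrite RInt_const. unfold minus, plus, opp, scal; simpl. unfold mult; simpl. ring.
Qed.

Lemma continuous_section_r (U : R -> R -> R) (x y a b : R) :
  differentiable_pt_lim U x y a b -> continuous (fun t => U x t) y.
Proof.
  intros H.
  apply (ex_derive_continuous (K := R_AbsRing) (V := R_NormedModule)).
  exists (a * 0 + b * 1). apply is_derive_Reals.
  apply (derivable_pt_lim_comp_2d U (fun _ => x) (fun t => t)); [exact H | |].
  - apply derivable_pt_lim_const.
  - apply derivable_pt_lim_id.
Qed.

Lemma continuous_section_l (U : R -> R -> R) (x y a b : R) :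
  differentiable_pt_lim U x y a b -> continuous (fun s => U s y) x.
Proof.
  intros H.
  apply (ex_derive_continuous (K := R_AbsRing) (V := R_NormedModule)).
  exists (a * 1 + b * 0). apply is_derive_Reals.
  apply (derivable_pt_lim_comp_2d U (fun s => s) (fun _ => y)); [exact H | |].
  - apply derivable_pt_lim_id.
  - apply derivable_pt_lim_const.
Qed.

Lemma ex_RInt_section_r (U V : R -> R -> R) (x y y' : R) :
  y <= y' -> (forall t, y <= t <= y' -> divergence_free_at U V x t) ->
  ex_RInt (fun t => U x t) y y'.
Proof.
  intros Hy H. apply (ex_RInt_continuous (V := R_CompleteNormedModule)). intros t.
  rewrite Rmin_left, Rmax_right by lra. intros Ht.
  destruct (H t Ht) as (a & b & c & HU & _).
  exact (continuous_section_r _ _ _ _ _ HU).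
Qed.

Lemma ex_RInt_section_l (U V : R -> R -> R) (x x' y : R) :
  x <= x' -> (forall s, x <= s <= x' -> divergence_free_at U V s y) ->
  ex_RInt (fun s => V s y) x x'.
Proof.
  intros Hy H. apply (ex_RInt_continuous (V := R_CompleteNormedModule)). intros t.
  rewrite Rmin_left, Rmax_right by lra. intros Ht.
  destruct (H t Ht) as (a & b & c & _ & HV).
  exact (continuous_section_l _ _ _ _ _ HV).
Qed.

Definition divergence_free_on (U V : R -> R -> R) (x y w h : R) : Prop :=
  forall s t, x <= s <= x + w -> y <= t <= y + h -> divergence_free_at U V s t.

Lemma flux_split_x U V x y w w' h :
  0 <= w -> 0 <= w' -> 0 <= h ->
  divergence_free_on U V x y (w + w') h ->
  flux U V x y (w + w') h = flux U V x y w h + flux U V (x + w) y w' h.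
Proof.
  intros Hw Hw' Hh H. unfold flux.
  assert (E : forall s, x <= s <= x + (w + w') -> ex_RInt (fun t => U s t) y (y + h)).
  { intros s Hs. apply (ex_RInt_section_r U V); [lra |]. intros t Ht. apply H; lra. }
  assert (E' : forall s s' t, x <= s -> s <= s' -> s' <= x + (w + w') -> y <= t <= y + h ->
      ex_RInt (fun r => V r t) s s').
  { intros s s' t ? ? ? Ht. apply (ex_RInt_section_l U V); [lra |]. intros r Hr. apply H; lra. }
  assert (D : forall s s', x <= s <= x + (w + w') -> x <= s' <= x + (w + w') ->
     RInt (fun t => U s t - U s' t) y (y + h) = RInt (U s) y (y + h) - RInt (U s') y (y + h)).
  { intros s s' Hs Hs'. apply (RInt_minus (V := R_CompleteNormedModule) (U s) (U s')); apply E; lra. }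
  rewrite !D by lra.
  assert (C : RInt (fun s => V s (y + h) - V s y) x (x + w) +
    RInt (fun s => V s (y + h) - V s y) (x + w) (x + w + w') =
    RInt (fun s => V s (y + h) - V s y) x (x + w + w')).
  { apply (RInt_Chasles (V := R_CompleteNormedModule));
    apply (ex_RInt_minus (V := R_NormedModule)); apply E'; lra. }
  replace (x + (w + w')) with (x + w + w') by ring. lra.
Qed.

Lemma flux_split_y U V x y w h h' :
  0 <= w -> 0 <= h -> 0 <= h' ->
  divergence_free_on U V x y w (h + h') ->
  flux U V x y w (h + h') = flux U V x y w h + flux U V x (y + h) w h'.
Proof.
  intros Hw Hh Hh' H. unfold flux.
  assert (E : forall t, y <= t <= y + (h + h') -> ex_RInt (fun s => V s t) x (x + w)).
  { intros t Ht. apply (ex_RInt_section_l U V); [lra |]. intros s Hs. apply H; lra. }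
  assert (E' : forall t t' s, y <= t -> t <= t' -> t' <= y + (h + h') -> x <= s <= x + w ->
      ex_RInt (fun r => U s r) t t').
  { intros t t' s ? ? ? Ht. apply (ex_RInt_section_r U V); [lra |]. intros r Hr. apply H; lra. }
  assert (D : forall t t', y <= t <= y + (h + h') -> y <= t' <= y + (h + h') ->
     RInt (fun s => V s t - V s t') x (x + w) =
     RInt (fun s => V s t) x (x + w) - RInt (fun s => V s t') x (x + w)).
  { intros s s' Hs Hs'.
    apply (RInt_minus (V := R_CompleteNormedModule) (fun r => V r s) (fun r => V r s')); apply E; lra. }
  rewrite !D by lra.
  assert (C : RInt (fun t => U (x + w) t - U x t) y (y + h) +
    RInt (fun t => U (x + w) t - U x t) (y + h) (y + h + h') =
    RInt (fun t => U (x + w) t - U x t) y (y + h + h')).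
  { apply (RInt_Chasles (V := R_CompleteNormedModule));
    apply (ex_RInt_minus (V := R_NormedModule)); apply E'; lra. }
  replace (y + (h + h')) with (y + h + h') by ring. lra.
Qed.

Lemma nested_halves (u : nat -> R) (w : R) :
  0 <= w -> (forall n, u n <= u (S n) <= u n + w / 2 ^ n / 2) ->
  exists p, forall n, u n <= p <= u n + w / 2 ^ n.
Proof.
  intros Hw Hu.
  assert (HS : forall n, w / 2 ^ (S n) = w / 2 ^ n / 2).
  { intros n. simpl. field. apply pow_nonzero. lra. }
  assert (Hup : forall n k, u (n + k)%nat + w / 2 ^ (n + k) <= u n + w / 2 ^ n).
  { intros n k. induction k as [| k IH]; [rewrite Nat.add_0_r; lra |].
    rewrite Nat.add_succ_r, HS. generalize (Hu (n + k)%nat). lra. }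
  assert (Hpos : forall n, 0 <= w / 2 ^ n).
  { intros n. apply Rmult_le_pos; [exact Hw |]. left. apply Rinv_0_lt_compat, pow_lt. lra. }
  assert (Hinc : forall n, u n <= u (S n)) by (intros n; apply Hu).
  destruct (ex_finite_lim_seq_incr u (u 0%nat + w / 2 ^ 0) Hinc) as [p Hp].
  { intros n. generalize (Hup 0%nat n) (Hpos n). simpl Nat.add. lra. }
  exists p. intros n. split.
  - exact (is_lim_seq_incr_compare u p Hp Hinc n).
  - change (Rbar_le p (u n + w / 2 ^ n)).
    apply (is_lim_seq_le (fun k => u (n + k)%nat) (fun _ => u n + w / 2 ^ n)).
    + intros k. generalize (Hup n k) (Hpos (n + k)%nat). lra.
    + apply is_lim_seq_ext with (fun k => u (k + n)%nat); [intros k; f_equal; lia |].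
      now apply is_lim_seq_incr_n.
    + apply is_lim_seq_const.
Qed.

(** Repeated subdivision: if every rectangle with property [P] has a quarter
    with property [P], then the quarters close down on a point. *)
Lemma nested_quarters (P : R -> R -> R -> R -> Prop) (x0 y0 w h : R) :
  (forall x y w h, P x y w h -> exists x' y',
     x <= x' <= x + w / 2 /\ y <= y' <= y + h / 2 /\ P x' y' (w / 2) (h / 2)) ->
  0 <= w -> 0 <= h -> P x0 y0 w h ->
  exists px py, forall n, exists x y,
    P x y (w / 2 ^ n) (h / 2 ^ n) /\
    x <= px <= x + w / 2 ^ n /\ y <= py <= y + h / 2 ^ n.
Proof.
  intros Hstep Hw Hh H0.
  assert (Hex : forall (n : nat) (c : R * R), exists c' : R * R,
    P (fst c) (snd c) (w / 2 ^ n) (h / 2 ^ n) ->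
      fst c <= fst c' <= fst c + w / 2 ^ n / 2 /\ snd c <= snd c' <= snd c + h / 2 ^ n / 2 /\
      P (fst c') (snd c') (w / 2 ^ n / 2) (h / 2 ^ n / 2)).
  { intros n c. destruct (classic (P (fst c) (snd c) (w / 2 ^ n) (h / 2 ^ n))) as [HP | HP].
    - destruct (Hstep _ _ _ _ HP) as (x' & y' & H). now exists (x', y').
    - exists c. tauto. }
  pose (next n c := proj1_sig (constructive_indefinite_description _ (Hex n c))).
  pose (c := fix c n := match n with O => (x0, y0) | S n => next n (c n) end).
  assert (HS : forall z n, z / 2 ^ (S n) = z / 2 ^ n / 2).
  { intros z n. simpl. field. apply pow_nonzero. lra. }
  assert (HP : forall n, P (fst (c n)) (snd (c n)) (w / 2 ^ n) (h / 2 ^ n)).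
  { induction n as [| n IH].
    - simpl. now rewrite !Rdiv_1_r.
    - rewrite !HS. apply (proj2_sig (constructive_indefinite_description _ (Hex n (c n))) IH). }
  assert (HN : forall n, fst (c n) <= fst (c (S n)) <= fst (c n) + w / 2 ^ n / 2 /\
     snd (c n) <= snd (c (S n)) <= snd (c n) + h / 2 ^ n / 2).
  { intros n. generalize (proj2_sig (constructive_indefinite_description _ (Hex n (c n))) (HP n)).
    simpl. unfold next. tauto. }
  destruct (nested_halves (fun n => fst (c n)) w Hw (fun n => proj1 (HN n))) as [px Hpx].
  destruct (nested_halves (fun n => snd (c n)) h Hh (fun n => proj2 (HN n))) as [py Hpy].
  exists px, py. intros n. exists (fst (c n)), (snd (c n)). auto.
Qed.

(** The linear part of the field contributes nothing because its divergence
    vanishes, and the remainder is small compared to the diameter; hence the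
    flux is small compared to the area of a rectangle of bounded
    eccentricity. *)
Lemma flux_small U V px py eps :
  divergence_free_at U V px py -> 0 < eps ->
  exists delta, 0 < delta /\ forall x y w h,
    0 <= w < delta -> 0 <= h < delta ->
    x <= px <= x + w -> y <= py <= y + h ->
    divergence_free_on U V x y w h ->
    Rabs (flux U V x y w h) <= eps * (w + h) ^ 2.
Proof.
  intros (a & b & c & HU & HV) Heps.
  assert (He : 0 < eps / 2) by lra.
  destruct (HU (mkposreal _ He)) as [d1 H1].
  destruct (HV (mkposreal _ He)) as [d2 H2]. simpl in H1, H2.
  exists (Rmin d1 d2). split. { apply Rmin_pos; [apply d1 | apply d2]. }
  intros x y w h Hw Hh Hx Hy H.
  assert (Hd1 := Rmin_l d1 d2). assert (Hd2 := Rmin_r d1 d2).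
  assert (K : forall s t, x <= s <= x + w -> y <= t <= y + h ->
    Rabs (s - px) <= w /\ Rabs (t - py) <= h).
  { intros s t Hs Ht. split; apply Rabs_le; lra. }
  assert (N : forall s t, x <= s <= x + w -> y <= t <= y + h ->
    eps / 2 * Rmax (Rabs (s - px)) (Rabs (t - py)) <= eps / 2 * (w + h)).
  { intros s t Hs Ht. apply Rmult_le_compat_l; [lra |].
    destruct (K s t Hs Ht). apply Rmax_lub; lra. }
  assert (BU : forall s t, x <= s <= x + w -> y <= t <= y + h ->
    Rabs (U s t - U px py - (a * (s - px) + b * (t - py))) <= eps / 2 * (w + h)).
  { intros s t Hs Ht. destruct (K s t Hs Ht).
    eapply Rle_trans; [apply H1; lra | now apply N]. }
  assert (BV : forall s t, x <= s <= x + w -> y <= t <= y + h ->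
    Rabs (V s t - V px py - (c * (s - px) + - a * (t - py))) <= eps / 2 * (w + h)).
  { intros s t Hs Ht. destruct (K s t Hs Ht).
    eapply Rle_trans; [apply H2; lra | now apply N]. }
  assert (IU : Rabs (RInt (fun t => U (x + w) t - U x t) y (y + h) - a * w * (y + h - y))
     <= (y + h - y) * (eps * (w + h))).
  { apply RInt_near_const; [lra | |].
    - apply (ex_RInt_minus (V := R_NormedModule)); apply (ex_RInt_section_r U V); try lra;
      intros t Ht; apply H; lra.
    - intros t Ht. generalize (BU (x + w) t ltac:(lra) Ht) (BU x t ltac:(lra) Ht).
      intros A B. apply Rabs_le_between in A, B. apply Rabs_le. lra. }
  assert (IV : Rabs (RInt (fun s => V s (y + h) - V s y) x (x + w) - - a * h * (x + w - x))
     <= (x + w - x) * (eps * (w + h))).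
  { apply RInt_near_const; [lra | |].
    - apply (ex_RInt_minus (V := R_NormedModule)); apply (ex_RInt_section_l U V); try lra;
      intros t Ht; apply H; lra.
    - intros t Ht. generalize (BV t (y + h) Ht ltac:(lra)) (BV t y Ht ltac:(lra)).
      intros A B. apply Rabs_le_between in A, B. apply Rabs_le. lra. }
  unfold flux. apply Rabs_le_between in IU, IV. apply Rabs_le. nra.
Qed.

(** Goursat's argument. If the flux is not zero, one quarter always carries at
    least the same flux per unit area as the whole; the rectangles obtained in
    this way shrink to a point, where [flux_small] is violated. *)
Lemma flux_zero U V x y w h :
  0 <= w -> 0 <= h -> divergence_free_on U V x y w h -> flux U V x y w h = 0.
Proof.
  intros Hw Hh H.
  destruct (Req_dec (flux U V x y w h) 0) as [| Hne]; [assumption | exfalso].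
  assert (Hw' : 0 < w).
  { destruct Hw as [| <-]; [assumption | exfalso; apply Hne].
    unfold flux. rewrite Rplus_0_r, RInt_point.
    rewrite (RInt_ext _ (fun _ => 0)) by (intros; exact (Rminus_diag _)). rewrite RInt_const.
    unfold scal, zero; simpl. unfold mult; simpl. ring. }
  assert (Hh' : 0 < h).
  { destruct Hh as [| <-]; [assumption | exfalso; apply Hne].
    unfold flux. rewrite Rplus_0_r, RInt_point.
    rewrite (RInt_ext _ (fun _ => 0)) by (intros; exact (Rminus_diag _)). rewrite RInt_const.
    unfold scal, zero; simpl. unfold mult; simpl. ring. }
  pose (c := Rabs (flux U V x y w h) / (w * h)).
  assert (Hwh : 0 < w * h) by (apply Rmult_lt_0_compat; assumption).
  assert (Hc : 0 < c).
  { apply Rdiv_lt_0_compat; [now apply Rabs_pos_lt | assumption]. }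
  destruct (nested_quarters (fun x' y' w' h' => 0 <= w' /\ 0 <= h' /\
     x <= x' /\ x' + w' <= x + w /\ y <= y' /\ y' + h' <= y + h /\
     c * (w' * h') <= Rabs (flux U V x' y' w' h')) x y w h) as (px & py & Hp).
  - intros x' y' w' h' (Hw1 & Hh1 & A1 & A2 & A3 & A4 & A5).
    assert (HX := flux_split_x U V x' y' (w' / 2) (w' / 2) h' ltac:(lra) ltac:(lra) Hh1).
    assert (HY := fun x'' Hx => flux_split_y U V x'' y' (w' / 2) (h' / 2) (h' / 2) ltac:(lra)
       ltac:(lra) ltac:(lra) Hx).
    replace (w' / 2 + w' / 2) with w' in HX by field.
    replace (h' / 2 + h' / 2) with h' in HY by field.
    rewrite HX in A5; [| intros s t Hs Ht; apply H; lra].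
    rewrite (HY x'), (HY (x' + w' / 2)) in A5 by (intros s t Hs Ht; apply H; lra).
    set (q := c * (w' / 2 * (h' / 2))).
    assert (Hq : c * (w' * h') = q + q + (q + q)) by (unfold q; field).
    rewrite Hq in A5.
    destruct (Rle_dec q (Rabs (flux U V x' y' (w' / 2) (h' / 2)))).
    { exists x', y'. repeat split; lra. }
    destruct (Rle_dec q (Rabs (flux U V x' (y' + h' / 2) (w' / 2) (h' / 2)))).
    { exists x', (y' + h' / 2). repeat split; lra. }
    destruct (Rle_dec q (Rabs (flux U V (x' + w' / 2) y' (w' / 2) (h' / 2)))).
    { exists (x' + w' / 2), y'. repeat split; lra. }
    exists (x' + w' / 2), (y' + h' / 2). repeat split; try lra. fold q.
    generalize (Rabs_triang (flux U V x' y' (w' / 2) (h' / 2) +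
      flux U V x' (y' + h' / 2) (w' / 2) (h' / 2))
      (flux U V (x' + w' / 2) y' (w' / 2) (h' / 2) +
         flux U V (x' + w' / 2) (y' + h' / 2) (w' / 2) (h' / 2)))
     (Rabs_triang (flux U V x' y' (w' / 2) (h' / 2))
      (flux U V x' (y' + h' / 2) (w' / 2) (h' / 2)))
     (Rabs_triang (flux U V (x' + w' / 2) y' (w' / 2) (h' / 2))
         (flux U V (x' + w' / 2) (y' + h' / 2) (w' / 2) (h' / 2))).
    lra.
  - lra.
  - lra.
  - repeat split; try lra. unfold c. right. field. lra.
  - assert (Hin : divergence_free_at U V px py).
    { destruct (Hp 0%nat) as (x' & y' & HP & Hx & Hy). simpl in HP, Hx, Hy.
      apply H; lra. }
    (* With this [eps] the bound of [flux_small] is half of [c] times the area. *)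
    pose (eps := c * (w * h) / (2 * (w + h) ^ 2)).
    assert (Heps : 0 < eps).
    { apply Rdiv_lt_0_compat; [now apply Rmult_lt_0_compat |].
      apply Rmult_lt_0_compat; [lra | apply pow_lt; lra]. }
    destruct (flux_small U V px py eps Hin Heps) as (delta & Hdelta & Hsmall).
    destruct (pow_lt_1_zero (/ 2) ltac:(rewrite Rabs_pos_eq; lra) (delta / (w + h)))
      as [n Hn]; [apply Rdiv_lt_0_compat; lra |].
    specialize (Hn n (le_n n)). rewrite Rabs_pos_eq in Hn by (apply pow_le; lra).
    rewrite pow_inv in Hn.
    destruct (Hp n) as (x' & y' & HP & Hx & Hy).
    set (k := / 2 ^ n) in *.
    assert (Hk : 0 < k) by (apply Rinv_0_lt_compat, pow_lt; lra).
    unfold Rdiv in HP, Hx, Hy. fold k in HP, Hx, Hy.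
    assert (Hkd : k * (w + h) < delta).
    { apply Rmult_lt_reg_r with (/ (w + h)); [apply Rinv_0_lt_compat; lra |].
      rewrite Rmult_assoc, Rinv_r by lra. unfold Rdiv in Hn. lra. }
    assert (Hs : Rabs (flux U V x' y' (w * k) (h * k)) <= eps * (w * k + h * k) ^ 2).
    { apply Hsmall; try assumption; try nra. intros s t Hs Ht. apply H; lra. }
    assert (He : eps * (w * k + h * k) ^ 2 = k ^ 2 * (c * (w * h)) / 2).
    { unfold eps. field. lra. }
    assert (0 < k ^ 2 * (c * (w * h))).
    { apply Rmult_lt_0_compat; [now apply pow_lt | now apply Rmult_lt_0_compat]. }
    rewrite He in Hs.
    replace (c * (w * k * (h * k))) with (k ^ 2 * (c * (w * h))) in HP by ring.
    lra.
Qed.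

(** * Complex differentiability *)

Definition C_continuous_at (q : C -> C) (z : C) : Prop :=
  forall eps, 0 < eps -> exists delta, 0 < delta /\
    forall w, Cmod (w - z) < delta -> Cmod (q w - q z) < eps.

(** Caratheodory's form of differentiability: the difference quotient extends
    continuously to [z]. The derivative is [q z]. In this form the rules for
    products, composites and inverses are algebra plus continuity, and a
    removable singularity is filled in by naming its slope function [q]. *)
Definition C_differentiable_at (g : C -> C) (z : C) : Prop :=
  exists (q : C -> C) (d : R), 0 < d /\ C_continuous_at q z /\
    forall w, Cmod (w - z) < d -> g w = (g z + q w * (w - z))%C.

Lemma Cmod_minus_sym (z w : C) : Cmod (z - w) = Cmod (w - z).
Proof. rewrite <- Cmod_opp. f_equal. ring. Qed.

Lemma locally_C_Cmod (z : C) (eps : R) : 0 < eps ->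
  locally (T := C_UniformSpace) z (fun w => Cmod (w - z) < eps).
Proof.
  intros Heps. assert (He : 0 < eps / 2) by lra.
  exists (mkposreal _ He). intros y [Hy1 Hy2].
  assert (N1 : Rabs (Re (y - z)%C) < eps / 2) by exact Hy1.
  assert (N2 : Rabs (Im (y - z)%C) < eps / 2) by exact Hy2.
  eapply Rle_lt_trans; [apply Cmod_2Rmax |].
  assert (Hm : Rmax (Rabs (Re (y - z)%C)) (Rabs (Im (y - z)%C)) < eps / 2) by now apply Rmax_lub_lt.
  unfold Re, Im in Hm. generalize (sqrt_sqrt 2 ltac:(lra)) (sqrt_pos 2).
  assert (Hp := Rle_trans _ _ _ (Rabs_pos _) (Rmax_l (Rabs (fst (y - z)%C)) (Rabs (snd (y - z)%C)))).
  nra.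
Qed.

Lemma Cmod_locally_C (z : C) (P : C -> Prop) :
  locally (T := C_UniformSpace) z P ->
  exists d, 0 < d /\ forall w, Cmod (w - z) < d -> P w.
Proof.
  intros [d Hd]. exists d. split; [apply d |]. intros w Hw. apply Hd.
  assert (Hm := Rmax_Cmod (w - z)%C).
  split; (eapply Rle_lt_trans; [| exact Hw]); (eapply Rle_trans; [| exact Hm]).
  - apply Rmax_l.
  - apply Rmax_r.
Qed.

Lemma C_continuous_const (c z : C) : C_continuous_at (fun _ => c) z.
Proof.
  intros eps Heps. exists 1. split; [lra |]. intros w _.
  replace (c - c)%C with (RtoC 0) by ring. now rewrite Cmod_0.
Qed.

Lemma C_continuous_id (z : C) : C_continuous_at (fun w => w) z.
Proof. intros eps Heps. now exists eps. Qed.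

Lemma C_continuous_plus (f g : C -> C) (z : C) :
  C_continuous_at f z -> C_continuous_at g z -> C_continuous_at (fun w => f w + g w)%C z.
Proof.
  intros Hf Hg eps Heps.
  destruct (Hf (eps / 2)) as (d & Hd & Hfd); [lra |].
  destruct (Hg (eps / 2)) as (d' & Hd' & Hgd); [lra |].
  exists (Rmin d d'). split; [now apply Rmin_pos |]. intros w Hw.
  assert (H1 := Hfd w (Rlt_le_trans _ _ _ Hw (Rmin_l _ _))).
  assert (H2 := Hgd w (Rlt_le_trans _ _ _ Hw (Rmin_r _ _))).
  replace (f w + g w - (f z + g z))%C with ((f w - f z) + (g w - g z))%C by ring.
  eapply Rle_lt_trans; [apply Cmod_triangle | lra].
Qed.

Lemma C_continuous_mult (f g : C -> C) (z : C) :
  C_continuous_at f z -> C_continuous_at g z -> C_continuous_at (fun w => f w * g w)%C z.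
Proof.
  intros Hf Hg eps Heps.
  pose (B := Cmod (f z) + Cmod (g z) + 1).
  assert (HB : 1 <= B) by (generalize (Cmod_ge_0 (f z)) (Cmod_ge_0 (g z)); unfold B; lra).
  assert (He : 0 < Rmin 1 (eps / (2 * B))).
  { apply Rmin_pos; [lra | apply Rdiv_lt_0_compat; lra]. }
  destruct (Hf _ He) as (d & Hd & Hfd). destruct (Hg _ He) as (d' & Hd' & Hgd).
  exists (Rmin d d'). split; [now apply Rmin_pos |]. intros w Hw.
  assert (H1 := Hfd w (Rlt_le_trans _ _ _ Hw (Rmin_l _ _))).
  assert (H2 := Hgd w (Rlt_le_trans _ _ _ Hw (Rmin_r _ _))).
  assert (L := Rmin_l 1 (eps / (2 * B))). assert (L' := Rmin_r 1 (eps / (2 * B))).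
  assert (Hw' : Cmod (f w) <= B).
  { replace (f w) with (f z + (f w - f z))%C by ring.
    eapply Rle_trans; [apply Cmod_triangle |]. generalize (Cmod_ge_0 (g z)). unfold B. lra. }
  replace (f w * g w - f z * g z)%C with (f w * (g w - g z) + (f w - f z) * g z)%C by ring.
  eapply Rle_lt_trans; [apply Cmod_triangle |]. rewrite !Cmod_mult.
  assert (Hz : Cmod (g z) <= B) by (generalize (Cmod_ge_0 (f z)); unfold B; lra).
  assert (E : B * (eps / (2 * B)) = eps / 2) by (field; lra).
  assert (N1 := Cmod_ge_0 (g w - g z)). assert (N2 := Cmod_ge_0 (f w - f z)).
  assert (A1 : Cmod (f w) * Cmod (g w - g z) <= B * Cmod (g w - g z)) by (apply Rmult_le_compat_r; lra).
  assert (A2 : Cmod (f w - f z) * Cmod (g z) <= Cmod (f w - f z) * B) by (apply Rmult_le_compat_l; lra).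
  assert (A3 : B * Cmod (g w - g z) < B * (eps / (2 * B))) by (apply Rmult_lt_compat_l; lra).
  assert (A4 : B * Cmod (f w - f z) < B * (eps / (2 * B))) by (apply Rmult_lt_compat_l; lra).
  lra.
Qed.

Lemma C_continuous_pow (f : C -> C) (z : C) (n : nat) :
  C_continuous_at f z -> C_continuous_at (fun w => Cpow (f w) n) z.
Proof.
  intros Hf. induction n as [| n IH]; simpl.
  - apply C_continuous_const.
  - now apply C_continuous_mult.
Qed.

Lemma C_continuous_comp (f g : C -> C) (z : C) :
  C_continuous_at g z -> C_continuous_at f (g z) -> C_continuous_at (fun w => f (g w)) z.
Proof.
  intros Hg Hf eps Heps. destruct (Hf eps Heps) as (d & Hd & Hfd).
  destruct (Hg d Hd) as (d' & Hd' & Hgd). exists d'. split; [assumption |]. auto.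
Qed.

Lemma C_continuous_inv (z : C) : z <> 0 -> C_continuous_at Cinv z.
Proof.
  intros Hz eps Heps. assert (Hm : 0 < Cmod z) by now apply Cmod_gt_0.
  exists (Rmin (Cmod z / 2) (eps * (Cmod z * Cmod z) / 2)). split.
  { apply Rmin_pos; [lra |]. apply Rdiv_lt_0_compat; [| lra].
    apply Rmult_lt_0_compat; [assumption |]. now apply Rmult_lt_0_compat. }
  intros w Hw.
  assert (H1 := Rlt_le_trans _ _ _ Hw (Rmin_l _ _)).
  assert (H2 := Rlt_le_trans _ _ _ Hw (Rmin_r _ _)).
  assert (Hw' : Cmod z / 2 <= Cmod w).
  { generalize (Cmod_triangle w (z - w)). replace (w + (z - w))%C with z by ring.
    rewrite (Cmod_minus_sym z w). lra. }
  assert (Hw0 : w <> 0) by (apply Cmod_gt_0; lra).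
  replace (/ w - / z)%C with ((z - w) / (w * z))%C by (field; auto).
  rewrite Cmod_div by now apply Cmult_neq_0.
  rewrite Cmod_mult, Cmod_minus_sym.
  apply Rlt_div_l; [apply Rmult_lt_0_compat; lra |].
  eapply Rlt_le_trans; [exact H2 |].
  assert (eps * (Cmod z / 2 * Cmod z) <= eps * (Cmod w * Cmod z)).
  { apply Rmult_le_compat_l; [lra |]. apply Rmult_le_compat_r; lra. }
  lra.
Qed.

Lemma C_continuous_ext_near (f g : C -> C) (z : C) (d : R) :
  0 < d -> (forall w, Cmod (w - z) < d -> f w = g w) ->
  C_continuous_at f z -> C_continuous_at g z.
Proof.
  intros Hd E Hf eps Heps. destruct (Hf eps Heps) as (d' & Hd' & H).
  exists (Rmin d d'). split; [now apply Rmin_pos |]. intros w Hw.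
  rewrite <- !E.
  - apply H. exact (Rlt_le_trans _ _ _ Hw (Rmin_r _ _)).
  - replace (z - z)%C with (RtoC 0) by ring. now rewrite Cmod_0.
  - exact (Rlt_le_trans _ _ _ Hw (Rmin_l _ _)).
Qed.

Lemma C_differentiable_continuous (g : C -> C) (z : C) :
  C_differentiable_at g z -> C_continuous_at g z.
Proof.
  intros (q & d & Hd & Hq & E).
  apply (C_continuous_ext_near (fun w => g z + q w * (w + - z))%C g z d Hd).
  { intros w Hw. now rewrite (E w Hw). }
  apply C_continuous_plus; [apply C_continuous_const |].
  apply C_continuous_mult; [exact Hq |].
  apply C_continuous_plus; [apply C_continuous_id | apply C_continuous_const].
Qed.

Lemma continuous_C_continuous (k : C -> C) (z : C) :
  C_continuous_at k z -> continuous (T := C_UniformSpace) (U := C_UniformSpace) k z.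
Proof.
  intros H P HP. destruct (Cmod_locally_C _ _ HP) as (e & He & HeP).
  destruct (H e He) as (d & Hd & Hk).
  apply (filter_imp (F := locally (T := C_UniformSpace) z) (fun w : C => Cmod (w - z) < d));
    [auto |].
  now apply locally_C_Cmod.
Qed.

Lemma continuous_Cmod (z : C) : continuous (T := C_UniformSpace) Cmod z.
Proof.
  intros P [e He]. unfold filtermap.
  apply (filter_imp (fun w : C => Cmod (w - z) < e)).
  - intros w Hw. apply He. change (Rabs (Cmod w - Cmod z) < e).
    eapply Rle_lt_trans; [| exact Hw].
    assert (T1 := Cmod_triangle z (w - z)). assert (T2 := Cmod_triangle w (z - w)).
    replace (z + (w - z))%C with w in T1 by ring.
    replace (w + (z - w))%C with z in T2 by ring. rewrite (Cmod_minus_sym z) in T2.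
    apply Rabs_le. lra.
  - apply locally_C_Cmod, e.
Qed.

Lemma C_differentiable_const (c z : C) : C_differentiable_at (fun _ => c) z.
Proof.
  exists (fun _ => RtoC 0), 1. split; [lra |]. split; [apply C_continuous_const |].
  intros w _. ring.
Qed.

Lemma C_differentiable_id (z : C) : C_differentiable_at (fun w => w) z.
Proof.
  exists (fun _ => RtoC 1), 1. split; [lra |]. split; [apply C_continuous_const |].
  intros w _. ring.
Qed.

Lemma C_differentiable_plus (f g : C -> C) (z : C) :
  C_differentiable_at f z -> C_differentiable_at g z ->
  C_differentiable_at (fun w => f w + g w)%C z.
Proof.
  intros (p & d & Hd & Hp & Ef) (q & d' & Hd' & Hq & Eg).
  exists (fun w => p w + q w)%C, (Rmin d d'). split; [now apply Rmin_pos |].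
  split; [now apply C_continuous_plus |]. intros w Hw.
  rewrite (Ef w (Rlt_le_trans _ _ _ Hw (Rmin_l _ _))).
  rewrite (Eg w (Rlt_le_trans _ _ _ Hw (Rmin_r _ _))). ring.
Qed.

Lemma C_differentiable_mult (f g : C -> C) (z : C) :
  C_differentiable_at f z -> C_differentiable_at g z ->
  C_differentiable_at (fun w => f w * g w)%C z.
Proof.
  intros Df Dg. assert (Cf := C_differentiable_continuous f z Df).
  destruct Df as (p & d & Hd & Hp & Ef). destruct Dg as (q & d' & Hd' & Hq & Eg).
  exists (fun w => p w * g z + f w * q w)%C, (Rmin d d'). split; [now apply Rmin_pos |].
  split.
  - apply C_continuous_plus; apply C_continuous_mult; auto using C_continuous_const.
  - intros w Hw.
    rewrite (Eg w (Rlt_le_trans _ _ _ Hw (Rmin_r _ _))).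
    rewrite (Ef w (Rlt_le_trans _ _ _ Hw (Rmin_l _ _))). ring.
Qed.

Lemma C_differentiable_comp (f g : C -> C) (z : C) :
  C_differentiable_at g z -> C_differentiable_at f (g z) ->
  C_differentiable_at (fun w => f (g w)) z.
Proof.
  intros Dg Df. assert (Cg := C_differentiable_continuous g z Dg).
  destruct Df as (p & d & Hd & Hp & Ef). destruct Dg as (q & d' & Hd' & Hq & Eg).
  destruct (Cg d Hd) as (d2 & Hd2 & Hg).
  exists (fun w => p (g w) * q w)%C, (Rmin d' d2). split; [now apply Rmin_pos |].
  split.
  - apply C_continuous_mult; [now apply C_continuous_comp | exact Hq].
  - intros w Hw.
    rewrite (Ef (g w)) by (apply Hg; exact (Rlt_le_trans _ _ _ Hw (Rmin_r _ _))).
    rewrite (Eg w (Rlt_le_trans _ _ _ Hw (Rmin_l _ _))) at 2. ring.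
Qed.

Lemma C_differentiable_inv (z : C) : z <> 0 -> C_differentiable_at Cinv z.
Proof.
  intros Hz. assert (Hm : 0 < Cmod z) by now apply Cmod_gt_0.
  (* On the ball of radius [|z|] around [z] the point 0 is avoided. *)
  exists (fun w => - / z * / w)%C, (Cmod z). split; [exact Hm |]. split.
  - apply C_continuous_mult; [apply C_continuous_const | now apply C_continuous_inv].
  - intros w Hw. assert (w <> 0).
    { intros ->. replace (0 - z)%C with (- z)%C in Hw by ring. rewrite Cmod_opp in Hw. lra. }
    field. auto.
Qed.

Lemma C_differentiable_pow (f : C -> C) (z : C) (n : nat) :
  C_differentiable_at f z -> C_differentiable_at (fun w => Cpow (f w) n) z.
Proof.
  intros Hf. induction n as [| n IH]; simpl.
  - apply C_differentiable_const.
  - now apply C_differentiable_mult.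
Qed.

Lemma ex_derive_C_differentiable (f : C -> C) (z : C) :
  ex_derive (K := C_AbsRing) (V := C_NormedModule) f z -> C_differentiable_at f z.
Proof.
  intros [l [_ Hl]].
  assert (Hl' := Hl z (fun P HP => HP)). clear Hl.
  exists (fun w => if Ceq_dec w z then l else ((f w - f z) / (w - z))%C), 1.
  split; [lra |]. split.
  - intros eps Heps.
    assert (He : 0 < eps / 2) by lra.
    destruct (Hl' (mkposreal _ He)) as [d Hd].
    exists d. split; [apply d |]. intros w Hw.
    destruct (Ceq_dec z z) as [_ | n]; [| now elim n].
    destruct (Ceq_dec w z) as [-> | Hne].
    { replace (l - l)%C with (RtoC 0) by ring. now rewrite Cmod_0. }
    assert (Hwz : (w - z)%C <> 0) by (intros E; apply Hne; now apply Ceq_minus).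
    specialize (Hd w Hw). simpl in Hd.
    change (Cmod (f w - f z - (w - z) * l) <= eps / 2 * Cmod (w - z)) in Hd.
    replace ((f w - f z) / (w - z) - l)%C with ((f w - f z - (w - z) * l) / (w - z))%C
      by (field; exact Hwz).
    rewrite Cmod_div by exact Hwz.
    apply Cmod_gt_0 in Hwz. apply Rlt_div_l; [assumption |]. nra.
  - intros w _. destruct (Ceq_dec w z) as [-> | Hne]; [ring |].
    field. intros E; apply Hne; now apply Ceq_minus.
Qed.

(** * The mean value property *)

(** The Cauchy-Riemann equations, in the form that the field
    [(Re g, - Im g)] is divergence free. *)
Lemma C_slope_real (g q : C -> C) (d x y : R) :
  0 < d -> C_continuous_at q (x, y) ->
  (forall w, Cmod (w - (x, y)) < d -> g w = (g (x, y) + q w * (w - (x, y)))%C) ->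
  differentiable_pt_lim (fun u v => Re (g (u, v))) x y (Re (q (x, y))) (- Im (q (x, y))) /\
  differentiable_pt_lim (fun u v => - Im (g (u, v))) x y (- Im (q (x, y))) (- Re (q (x, y))).
Proof.
  intros Hd Hq E.
  assert (K : forall eps : posreal, exists delta : posreal, forall u v,
    Rabs (u - x) < delta -> Rabs (v - y) < delta ->
    Cmod (g (u, v) - g (x, y) - q (x, y) * (u - x, v - y))
      <= eps * Rmax (Rabs (u - x)) (Rabs (v - y))).
  { intros eps. assert (He : 0 < eps / 2) by (destruct eps; simpl; lra).
    destruct (Hq (eps / 2) He) as (d' & Hd' & H).
    assert (Hm : 0 < Rmin d d' / 2) by (generalize (Rmin_pos _ _ Hd Hd'); lra).
    exists (mkposreal _ Hm). simpl. intros u v Hu Hv.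
    assert (Hs : Cmod (u - x, v - y) <= 2 * Rmax (Rabs (u - x)) (Rabs (v - y))).
    { eapply Rle_trans; [apply Cmod_2Rmax |]. simpl.
      apply Rmult_le_compat_r.
      - eapply Rle_trans; [apply Rabs_pos | apply Rmax_l].
      - generalize (sqrt_sqrt 2 ltac:(lra)) (sqrt_pos 2). nra. }
    assert (Hlt : Cmod ((u, v) - (x, y)) < Rmin d d').
    { change ((u, v) - (x, y))%C with (u - x, v - y).
      assert (Rmax (Rabs (u - x)) (Rabs (v - y)) < Rmin d d' / 2) by now apply Rmax_lub_lt.
      lra. }
    rewrite (E (u, v)) by exact (Rlt_le_trans _ _ _ Hlt (Rmin_l _ _)).
    assert (H2 := H (u, v) (Rlt_le_trans _ _ _ Hlt (Rmin_r _ _))).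
    change (u - x, v - y) with ((u, v) - (x, y))%C in *.
    replace (g (x, y) + q (u, v) * ((u, v) - (x, y)) - g (x, y) - q (x, y) * ((u, v) - (x, y)))%C
      with ((q (u, v) - q (x, y)) * ((u, v) - (x, y)))%C by ring.
    rewrite Cmod_mult.
    apply Rle_trans with (eps / 2 * Cmod ((u, v) - (x, y))).
    - apply Rmult_le_compat_r; [apply Cmod_ge_0 | lra].
    - destruct eps; simpl in *. nra. }
  split; intros eps; destruct (K eps) as [delta H]; exists delta; intros u v Hu Hv;
    specialize (H u v Hu Hv); (eapply Rle_trans; [| exact H]).
  - eapply Rle_trans; [| apply re_le_Cmod]. right. f_equal. unfold Re, Im. simpl. ring.
  - eapply Rle_trans; [| eapply Rle_trans; [apply Rmax_r | apply Rmax_Cmod]].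
    right. rewrite <- Rabs_Ropp. f_equal.
    unfold Re, Im. simpl. ring.
Qed.

Lemma differentiable_pt_lim_Rmult (x y : R) : differentiable_pt_lim Rmult x y y x.
Proof.
  intros eps. exists eps. intros u v Hu Hv.
  replace (u * v - x * y - (y * (u - x) + x * (v - y))) with ((u - x) * (v - y)) by ring.
  rewrite Rabs_mult. apply Rmult_le_compat; try apply Rabs_pos; [lra | apply Rmax_r].
Qed.

Lemma differentiable_pt_lim_prod (f g : R -> R) (x y a b : R) :
  derivable_pt_lim f x a -> derivable_pt_lim g y b ->
  differentiable_pt_lim (fun u v => f u * g v) x y (a * g y) (f x * b).
Proof.
  intros Hf Hg.
  assert (P2 : differentiable_pt_lim (fun _ v => g v) x y 0 b).
  { intros eps. destruct (differentiable_pt_lim_proj1_0 g y x b Hg eps) as [d H].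
    exists d. intros u v Hu Hv. specialize (H v u Hv Hu).
    rewrite Rmax_comm. eapply Rle_trans; [| exact H]. right. f_equal. ring. }
  assert (H := differentiable_pt_lim_comp Rmult (fun u _ => f u) (fun _ v => g v) x y
     (g y) (f x) a 0 0 b (differentiable_pt_lim_Rmult _ _)
     (differentiable_pt_lim_proj1_0 _ _ _ _ Hf) P2).
  simpl in H. replace (a * g y) with (g y * a + f x * 0) by ring.
  replace (f x * b) with (g y * 0 + f x * b) by ring. exact H.
Qed.

Definition polar (r t : R) : C := (r * cos t, r * sin t).

Lemma Cmod_polar (r t : R) : 0 <= r -> Cmod (polar r t) = r.
Proof.
  intros Hr. unfold Cmod, polar. simpl fst; simpl snd.
  replace ((r * cos t) ^ 2 + (r * sin t) ^ 2) with (r * r * (Rsqr (sin t) + Rsqr (cos t)))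
    by (unfold Rsqr; ring).
  rewrite sin2_cos2, Rmult_1_r. now apply sqrt_square.
Qed.

(** In the logarithmic coordinate [s + i t] the function [g] stays complex
    differentiable, so its associated field stays divergence free. *)
Lemma polar_divergence_free (g : C -> C) (s t : R) :
  C_differentiable_at g (polar (exp s) t) ->
  divergence_free_at (fun s t => Re (g (polar (exp s) t)))
                     (fun s t => - Im (g (polar (exp s) t))) s t.
Proof.
  intros Hg. destruct Hg as (q & d & Hd & Hq & E).
  destruct (C_slope_real g q d _ _ Hd Hq E) as [HU HV].
  assert (HX := differentiable_pt_lim_prod exp cos s t _ _
    (derivable_pt_lim_exp s) (derivable_pt_lim_cos t)).
  assert (HY := differentiable_pt_lim_prod exp sin s t _ _
    (derivable_pt_lim_exp s) (derivable_pt_lim_sin t)).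
  assert (DU := differentiable_pt_lim_comp _ _ _ s t _ _ _ _ _ _ HU HX HY).
  assert (DV := differentiable_pt_lim_comp _ _ _ s t _ _ _ _ _ _ HV HX HY).
  eexists _, _, _. split; [exact DU |].
  match goal with |- differentiable_pt_lim _ _ _ ?c ?e =>
    match type of DV with differentiable_pt_lim _ _ _ ?c' ?e' =>
      unify c c'; replace e with e' by ring end end.
  exact DV.
Qed.

(** On the rectangle [s_0, ln r] x [0, 2 pi] in the logarithmic coordinate the
    horizontal sides carry opposite fluxes by periodicity, so the vertical sides
    do as well: the mean of [g] over circles is independent of the radius. As
    the radius tends to 0 it tends to [g 0]. *)
Lemma circle_mean (g : C -> C) (r : R) :
  0 < r -> (forall z, Cmod z <= r -> C_differentiable_at g z) ->
  is_RInt (fun t => Re (g (polar r t))) 0 (2 * PI) (2 * PI * Re (g 0)).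
Proof.
  intros Hr Hg. assert (Hpi := PI_RGT_0).
  set (U := fun s t => Re (g (polar (exp s) t))).
  set (V := fun s t => - Im (g (polar (exp s) t))).
  assert (Hdf : forall s t, s <= ln r -> divergence_free_at U V s t).
  { intros s t Hs. apply polar_divergence_free, Hg.
    rewrite Cmod_polar by (left; apply exp_pos).
    rewrite <- (exp_ln r Hr). destruct Hs as [Hs | ->]; [left; now apply exp_increasing | right; reflexivity]. }
  assert (Hex : forall s, s <= ln r -> ex_RInt (U s) 0 (2 * PI)).
  { intros s Hs. apply (ex_RInt_section_r U V); [lra |]. intros; now apply Hdf. }
  assert (Hconst : forall s, s <= ln r -> RInt (U (ln r)) 0 (2 * PI) = RInt (U s) 0 (2 * PI)).
  { intros s Hs.
    assert (F := flux_zero U V s 0 (ln r - s) (2 * PI) ltac:(lra) ltac:(lra)).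
    unfold flux in F. rewrite !Rplus_0_l in F.
    replace (s + (ln r - s)) with (ln r) in F by ring.
    rewrite (RInt_ext (fun s => V s (2 * PI) - V s 0) (fun _ => 0)) in F.
    2:{ intros x _. unfold V, polar. rewrite cos_2PI, sin_2PI, cos_0, sin_0. exact (Rminus_diag _). }
    rewrite RInt_const in F. unfold scal in F; simpl in F; unfold mult in F; simpl in F.
    rewrite (RInt_minus (V := R_CompleteNormedModule) (U (ln r)) (U s)) in F
      by (apply Hex; lra).
    unfold minus, plus, opp in F; simpl in F.
    assert (F' := F ltac:(intros x y Hx Hy; apply Hdf; lra)). lra. }
  assert (HI : RInt (U (ln r)) 0 (2 * PI) = 2 * PI * Re (g 0)).
  { destruct (Req_dec (RInt (U (ln r)) 0 (2 * PI) - 2 * PI * Re (g 0)) 0) as [E | Hne]; [lra | exfalso].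
    set (D := Rabs (RInt (U (ln r)) 0 (2 * PI) - 2 * PI * Re (g 0))).
    assert (HD : 0 < D) by now apply Rabs_pos_lt.
    assert (He : 0 < D / (4 * PI)) by (apply Rdiv_lt_0_compat; lra).
    destruct (C_differentiable_continuous g 0 ltac:(apply Hg; rewrite Cmod_0; lra) _ He)
      as (d & Hd & Hc).
    set (s := ln (Rmin r (d / 2))).
    assert (Hm : 0 < Rmin r (d / 2)) by (apply Rmin_pos; lra).
    assert (Hs : s <= ln r).
    { destruct (Rmin_l r (d / 2)) as [Hl | Hl].
      - left. now apply ln_increasing.
      - right. unfold s. now rewrite Hl. }
    assert (N : Rabs (RInt (U s) 0 (2 * PI) - Re (g 0) * (2 * PI - 0))
       <= (2 * PI - 0) * (D / (4 * PI))).
    { apply RInt_near_const; [lra | now apply Hex |]. intros t _.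
      left. unfold U. eapply Rle_lt_trans; [| apply (Hc (polar (exp s) t))].
      - eapply Rle_trans; [| apply re_le_Cmod]. right. f_equal.
      - replace (polar (exp s) t - 0)%C with (polar (exp s) t) by ring.
        rewrite Cmod_polar by (left; apply exp_pos). unfold s. rewrite exp_ln by exact Hm.
        generalize (Rmin_r r (d / 2)). lra. }
    rewrite <- (Hconst s Hs) in N.
    replace ((2 * PI - 0) * (D / (4 * PI))) with (D / 2) in N by (field; lra).
    replace (Re (g 0) * (2 * PI - 0)) with (2 * PI * Re (g 0)) in N by ring.
    fold D in N. lra. }
  rewrite <- HI. replace (fun t => Re (g (polar r t))) with (U (ln r)).
  - apply (RInt_correct (V := R_CompleteNormedModule)). apply Hex. lra.
  - unfold U. now rewrite exp_ln.
Qed.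

(** The mean value property for [conj (g 0) * g], whose value at 0 is
    [|g 0|^2]. *)
Lemma mean_value_bound (g : C -> C) (r M : R) :
  0 < r -> (forall z, Cmod z <= r -> C_differentiable_at g z) ->
  (forall z, Cmod z = r -> Cmod (g z) <= M) -> Cmod (g 0) <= M.
Proof.
  intros Hr Hg HM.
  assert (HI := circle_mean (fun z => Cconj (g 0) * g z)%C r Hr).
  assert (HI' := HI (fun z Hz => C_differentiable_mult _ _ _ (C_differentiable_const _ _) (Hg z Hz))).
  clear HI. simpl in HI'.
  assert (Hpi := PI_RGT_0).
  assert (B : 2 * PI * Re (Cconj (g 0) * g 0)%C <= (2 * PI - 0) * (Cmod (g 0) * M)).
  { eapply Rle_trans; [apply Rle_abs |].
    apply (norm_RInt_le_const (V := R_NormedModule) _ 0 (2 * PI) _ _ ltac:(lra)) with (2 := HI').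
    intros t _. change (Rabs (Re (Cconj (g 0) * g (polar r t))%C) <= Cmod (g 0) * M).
    eapply Rle_trans; [apply re_le_Cmod |]. rewrite Cmod_mult, Cmod_conj.
    apply Rmult_le_compat_l; [apply Cmod_ge_0 |]. apply HM, Cmod_polar. lra. }
  assert (E : Re (Cconj (g 0) * g 0)%C = Cmod (g 0) ^ 2).
  { rewrite Cmod2_alt. unfold Re, Im. simpl. ring. }
  rewrite E, Rminus_0_r in B.
  assert (HM0 : 0 <= M).
  { eapply Rle_trans; [apply Cmod_ge_0 | apply (HM (polar r 0)), Cmod_polar; lra]. }
  destruct (Rle_lt_or_eq_dec _ _ (Cmod_ge_0 (g 0))) as [Hp | <-]; [| assumption].
  apply Rmult_le_reg_l with (2 * PI * Cmod (g 0)); nra.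
Qed.

(** * The lemmas of Schwarz and Pick *)

Definition moebius (a z : C) : C := ((z + a) / (1 + Cconj a * z))%C.

(** This is [cosh^2] of the hyperbolic distance between [z] and [w], and also
    [1 / (1 - rho^2)] for their pseudohyperbolic distance [rho]; see
    [moebius_gap_point_pair]. *)
Definition point_pair (z w : C) : R :=
  Cmod (1 - Cconj w * z) ^ 2 / ((1 - Cmod z ^ 2) * (1 - Cmod w ^ 2)).

Lemma disc_gap (z : C) : unit_disc z -> 0 < 1 - Cmod z ^ 2.
Proof. unfold unit_disc. generalize (Cmod_ge_0 z). nra. Qed.

Lemma unit_disc_0 : unit_disc 0.
Proof. unfold unit_disc. rewrite Cmod_0. lra. Qed.

Lemma unit_disc_opp (a : C) : unit_disc a -> unit_disc (- a).
Proof. unfold unit_disc. now rewrite Cmod_opp. Qed.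

Lemma moebius_denominator_lower (a z : C) :
  unit_disc z -> 1 - Cmod a <= Cmod (1 + Cconj a * z).
Proof.
  unfold unit_disc. intros Hz.
  generalize (Cmod_triangle (1 + Cconj a * z) (- (Cconj a * z))).
  replace (1 + Cconj a * z + - (Cconj a * z))%C with (RtoC 1) by ring.
  rewrite Cmod_1, Cmod_opp, Cmod_mult, Cmod_conj.
  generalize (Cmod_ge_0 a) (Cmod_ge_0 z). nra.
Qed.

Lemma moebius_denominator_neq_0 (a z : C) :
  unit_disc a -> unit_disc z -> (1 + Cconj a * z)%C <> 0.
Proof.
  intros Ha Hz. apply Cmod_gt_0.
  generalize (moebius_denominator_lower a z Hz). unfold unit_disc in Ha. lra.
Qed.

Lemma moebius_numerator_gap (a z : C) :
  Cmod (1 + Cconj a * z) ^ 2 - Cmod (z + a) ^ 2 = (1 - Cmod z ^ 2) * (1 - Cmod a ^ 2).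
Proof. rewrite !Cmod2_alt. unfold Re, Im. simpl. ring. Qed.

Lemma moebius_gap (a z : C) : unit_disc a -> unit_disc z ->
  1 - Cmod (moebius a z) ^ 2
    = (1 - Cmod z ^ 2) * (1 - Cmod a ^ 2) / Cmod (1 + Cconj a * z) ^ 2.
Proof.
  intros Ha Hz. assert (Hd := moebius_denominator_neq_0 a z Ha Hz).
  unfold moebius. rewrite Cmod_div, <- moebius_numerator_gap by exact Hd.
  apply Cmod_gt_0 in Hd. field. lra.
Qed.

Lemma moebius_in_disc (a z : C) : unit_disc a -> unit_disc z -> unit_disc (moebius a z).
Proof.
  intros Ha Hz.
  assert (0 < 1 - Cmod (moebius a z) ^ 2).
  { rewrite moebius_gap by assumption. apply Rdiv_lt_0_compat.
    - apply Rmult_lt_0_compat; now apply disc_gap.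
    - apply pow_lt, Cmod_gt_0. now apply moebius_denominator_neq_0. }
  unfold unit_disc. generalize (Cmod_ge_0 (moebius a z)). nra.
Qed.

Lemma moebius_0 (a : C) : moebius a 0 = a.
Proof. unfold moebius. rewrite Cmult_0_r, Cplus_0_r. field. Qed.

Lemma moebius_opp_self (a : C) : moebius (- a) a = 0.
Proof.
  unfold moebius. replace (a + - a)%C with (RtoC 0) by ring. apply Cmult_0_l.
Qed.

Lemma moebius_inverse (a z : C) : unit_disc a -> unit_disc z ->
  moebius a (moebius (- a) z) = z.
Proof.
  intros Ha Hz.
  assert (H1 := moebius_denominator_neq_0 (- a) z (unit_disc_opp a Ha) Hz).
  unfold moebius in *. rewrite Copp_conj in *.
  assert (E : (1 - Cconj a * a)%C <> 0).
  { intros E. apply (f_equal Re) in E. revert E. generalize (disc_gap a Ha).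
    rewrite Cmod2_alt. unfold Re, Im. simpl. lra. }
  field. split; [exact H1 |].
  replace (1 + - Cconj a * z + Cconj a * (z + - a))%C with (1 - Cconj a * a)%C by ring.
  exact E.
Qed.

Lemma moebius_differentiable (a z : C) :
  unit_disc a -> unit_disc z -> C_differentiable_at (moebius a) z.
Proof.
  intros Ha Hz. unfold moebius, Cdiv.
  apply C_differentiable_mult.
  - apply C_differentiable_plus; [apply C_differentiable_id | apply C_differentiable_const].
  - apply (C_differentiable_comp Cinv (fun w => 1 + Cconj a * w)%C).
    + apply C_differentiable_plus; [apply C_differentiable_const |].
      apply C_differentiable_mult; [apply C_differentiable_const | apply C_differentiable_id].
    + apply C_differentiable_inv. now apply moebius_denominator_neq_0.
Qed.

Lemma moebius_gap_point_pair (z w : C) : unit_disc z -> unit_disc w ->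
  1 - Cmod (moebius (- w) z) ^ 2 = / point_pair z w.
Proof.
  intros Hz Hw. rewrite moebius_gap by auto using unit_disc_opp.
  assert (Hd := moebius_denominator_neq_0 (- w) z (unit_disc_opp w Hw) Hz).
  unfold point_pair. rewrite Copp_conj, Cmod_opp in *.
  replace (1 + - Cconj w * z)%C with (1 - Cconj w * z)%C in * by ring.
  apply Cmod_gt_0 in Hd. generalize (disc_gap z Hz) (disc_gap w Hw). intros.
  field. repeat split; lra.
Qed.

Lemma point_pair_pos (z w : C) : unit_disc z -> unit_disc w -> 0 < point_pair z w.
Proof.
  intros Hz Hw. apply Rdiv_lt_0_compat.
  - apply pow_lt, Cmod_gt_0.
    assert (Hd := moebius_denominator_neq_0 (- w) z (unit_disc_opp w Hw) Hz).
    rewrite Copp_conj in Hd.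
    now replace (1 - Cconj w * z)%C with (1 + - Cconj w * z)%C by ring.
  - apply Rmult_lt_0_compat; now apply disc_gap.
Qed.

Definition self_map (f : C -> C) : Prop := forall z, unit_disc z -> unit_disc (f z).

(** A disc automorphism moves [p] to the centre and circles of radius close to
    1 to curves close to the boundary; then [mean_value_bound] applies. *)
Lemma maximum_principle (g : C -> C) (R0 M : R) (p : C) :
  (forall z, unit_disc z -> C_differentiable_at g z) ->
  0 <= R0 < 1 -> (forall z, unit_disc z -> R0 < Cmod z -> Cmod (g z) <= M) ->
  unit_disc p -> Cmod (g p) <= M.
Proof.
  intros Hg HR HM Hp.
  pose (c := (1 - Cmod p) ^ 2 * (1 - R0 ^ 2)).
  assert (Hp0 := Cmod_ge_0 p). assert (Hp1 : Cmod p < 1) by exact Hp.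
  assert (Hc : 0 < c) by (apply Rmult_lt_0_compat; nra).
  assert (Hc1 : c <= 1).
  { unfold c. rewrite <- (Rmult_1_l 1). apply Rmult_le_compat; nra. }
  (* [1 - r^2 = c / 2] makes the gap of [moebius p] at radius [r] at most half of [1 - R0^2]. *)
  pose (r := sqrt (1 - c / 2)).
  assert (Hr2 : r * r = 1 - c / 2) by (apply sqrt_sqrt; lra).
  assert (Hr : 0 < r) by (apply sqrt_lt_R0; lra).
  assert (Hr1 : r < 1) by nra.
  rewrite <- (moebius_0 p).
  apply (mean_value_bound (fun z => g (moebius p z)) r M Hr).
  - intros z Hz. assert (Hz' : unit_disc z) by (unfold unit_disc; lra).
    apply C_differentiable_comp; [now apply moebius_differentiable |].
    apply Hg. now apply moebius_in_disc.
  - intros z Hz. assert (Hz' : unit_disc z) by (unfold unit_disc; lra).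
    apply HM; [now apply moebius_in_disc |].
    assert (Hgap := moebius_gap p z Hp Hz').
    assert (Hlow := moebius_denominator_lower p z Hz').
    assert (Hb : 1 - Cmod (moebius p z) ^ 2 <= (1 - R0 ^ 2) / 2).
    { rewrite Hgap, Hz. apply Rle_div_l; [apply pow_lt; lra |].
      replace (1 - r ^ 2) with (c / 2) by (simpl; lra). unfold c.
      assert ((1 - Cmod p) ^ 2 <= Cmod (1 + Cconj p * z) ^ 2) by (apply pow_incr; lra).
      assert (0 < 1 - R0 ^ 2) by nra. assert (0 <= Cmod p ^ 2) by nra.
      assert (0 <= (1 - Cmod p) ^ 2 * (1 - R0 ^ 2)) by (fold c; lra).
      nra. }
    assert (0 < 1 - R0 ^ 2) by nra. assert (N := Cmod_ge_0 (moebius p z)). nra.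
Qed.

Lemma pow_bounded_le_1 (x B : R) : (forall n, x ^ n <= B) -> x <= 1.
Proof.
  intros H. destruct (Rle_dec x 1) as [| Hx]; [assumption | exfalso].
  destruct (Pow_x_infinity x ltac:(rewrite Rabs_pos_eq; lra) (B + 1)) as [N HN].
  specialize (HN N (le_n N)). rewrite Rabs_pos_eq in HN by (apply pow_le; lra).
  generalize (H N). lra.
Qed.

(** The quotient [h z = F z / z], with [h 0 = F' 0], is only known to be
    continuous at 0, but [z * h z ^ n] is differentiable there, with slope
    function [h ^ n]. The maximum principle bounds [|p| |h p|^n] by
    [(1 / R0)^n] for every [R0 < 1], and letting [n] tend to infinity gives
    [|h p| <= 1 / R0]. *)
Lemma schwarz_lemma (F : C -> C) (p : C) :
  (forall z, unit_disc z -> C_differentiable_at F z) ->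
  self_map F -> F 0 = 0 ->
  unit_disc p -> Cmod (F p) <= Cmod p.
Proof.
  intros HF HD H0 Hp.
  destruct (Ceq_dec p 0) as [-> | Hp0]; [rewrite H0; lra |].
  destruct (HF 0 unit_disc_0) as (q & d & Hd & Hq & E).
  pose (h := fun z => if Ceq_dec z 0 then q 0 else (F z / z)%C).
  assert (Hh : C_continuous_at h 0).
  { apply (C_continuous_ext_near q h 0 d Hd); [| exact Hq].
    intros w Hw. unfold h. destruct (Ceq_dec w 0) as [-> | Hw0]; [reflexivity |].
    rewrite (E w Hw), H0. field. exact Hw0. }
  assert (Hdiff : forall n z, unit_disc z -> C_differentiable_at (fun w => w * Cpow (h w) n)%C z).
  { intros n z Hz. destruct (Ceq_dec z 0) as [-> | Hz0].
    - exists (fun w => Cpow (h w) n), 1. split; [lra |]. split; [now apply C_continuous_pow |].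
      intros w _. ring.
    - apply C_differentiable_mult; [apply C_differentiable_id |].
      apply C_differentiable_pow.
      assert (Hdz : C_differentiable_at (fun w => F w * / w)%C z).
      { apply C_differentiable_mult; [now apply HF | now apply C_differentiable_inv]. }
      assert (Hpos : 0 < Cmod z) by now apply Cmod_gt_0.
      destruct Hdz as (k & e & He & Hk & Ek).
      exists k, (Rmin e (Cmod z)). split; [now apply Rmin_pos |]. split; [exact Hk |].
      intros w Hw. unfold h. destruct (Ceq_dec z 0) as [? | _]; [contradiction |].
      destruct (Ceq_dec w 0) as [-> | _].
      + exfalso. replace (0 - z)%C with (- z)%C in Hw by ring. rewrite Cmod_opp in Hw.
        generalize (Rmin_r e (Cmod z)). lra.
      + apply Ek. exact (Rlt_le_trans _ _ _ Hw (Rmin_l _ _)). }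
  assert (Hval : forall z : C, z <> 0 -> Cmod (h z) = Cmod (F z) / Cmod z).
  { intros z Hz. unfold h. destruct (Ceq_dec z 0); [contradiction |]. now apply Cmod_div. }
  assert (Hpp : 0 < Cmod p) by now apply Cmod_gt_0.
  assert (Hbound : forall R0, 0 < R0 < 1 -> R0 * Cmod (h p) <= 1).
  { intros R0 HR. apply (pow_bounded_le_1 _ (/ Cmod p)). intros n.
    assert (HB : Cmod (p * Cpow (h p) n) <= (/ R0) ^ n).
    { apply (maximum_principle (fun w => w * Cpow (h w) n)%C R0); auto; [lra |].
      intros z Hz HzR. assert (Hz0 : z <> 0) by (apply Cmod_gt_0; lra).
      rewrite Cmod_mult, Cmod_pow, (Hval z Hz0).
      assert (Hz1 : Cmod z < 1) by exact Hz. assert (HFz : Cmod (F z) < 1) by exact (HD z Hz).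
      assert (HFz0 := Cmod_ge_0 (F z)).
      assert (Hq1 : 0 <= Cmod (F z) / Cmod z <= / R0).
      { split.
        - apply Rmult_le_pos; [assumption |]. left. apply Rinv_0_lt_compat. lra.
        - apply Rle_trans with (1 * / Cmod z).
          + apply Rmult_le_compat_r; [| lra]. left. apply Rinv_0_lt_compat. lra.
          + rewrite Rmult_1_l. apply Rinv_le_contravar; lra. }
      apply Rle_trans with (1 * (/ R0) ^ n); [| lra].
      apply Rmult_le_compat; [lra | now apply pow_le | lra | now apply pow_incr]. }
    rewrite Cmod_mult, Cmod_pow, pow_inv in HB.
    rewrite Rpow_mult_distr.
    assert (HRn : 0 < R0 ^ n) by (apply pow_lt; lra).
    apply Rmult_le_reg_l with (Cmod p); [assumption |]. rewrite Rinv_r by lra.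
    apply Rmult_le_reg_l with (/ R0 ^ n); [now apply Rinv_0_lt_compat |].
    replace (/ R0 ^ n * (Cmod p * (R0 ^ n * Cmod (h p) ^ n))) with (Cmod p * Cmod (h p) ^ n)
      by (field; lra).
    lra. }
  assert (Hfin : Cmod (h p) <= 1).
  { destruct (Rle_dec (Cmod (h p)) 1) as [| Hgt]; [assumption | exfalso].
    assert (Hx : 1 < Cmod (h p)) by lra.
    assert (Hi : 0 < / Cmod (h p) < 1).
    { split; [apply Rinv_0_lt_compat; lra |]. rewrite <- Rinv_1. apply Rinv_lt_contravar; lra. }
    generalize (Hbound ((/ Cmod (h p) + 1) / 2) ltac:(lra)).
    replace ((/ Cmod (h p) + 1) / 2 * Cmod (h p)) with ((1 + Cmod (h p)) / 2) by (field; lra).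
    lra. }
  rewrite (Hval p Hp0) in Hfin. apply Rle_div_l in Hfin; lra.
Qed.

(** Disc automorphisms reduce this to the Schwarz lemma. *)
Lemma schwarz_pick (f : C -> C) (z w : C) :
  (forall z, unit_disc z -> C_differentiable_at f z) ->
  self_map f ->
  unit_disc z -> unit_disc w -> point_pair (f z) (f w) <= point_pair z w.
Proof.
  intros Hf HD Hz Hw.
  assert (Hfw := unit_disc_opp _ (HD w Hw)). assert (Hw' := unit_disc_opp _ Hw).
  assert (S := schwarz_lemma (fun u => moebius (- f w) (f (moebius w u))) (moebius (- w) z)).
  simpl in S. rewrite moebius_inverse, moebius_0, moebius_opp_self in S by assumption.
  assert (B : Cmod (moebius (- f w) (f z)) <= Cmod (moebius (- w) z)).
  { apply S; [| | reflexivity | now apply moebius_in_disc].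
    - intros u Hu. assert (Hmu := moebius_in_disc w u Hw Hu).
      apply (C_differentiable_comp (moebius (- f w)) (fun u => f (moebius w u))).
      + apply C_differentiable_comp; [now apply moebius_differentiable | now apply Hf].
      + apply moebius_differentiable; auto.
    - intros u Hu. apply moebius_in_disc; auto using moebius_in_disc. }
  assert (P1 := point_pair_pos _ _ Hz Hw).
  assert (P2 := point_pair_pos _ _ (HD z Hz) (HD w Hw)).
  rewrite <- (Rinv_inv (point_pair z w)), <- (Rinv_inv (point_pair (f z) (f w))).
  apply Rinv_le_contravar; [now apply Rinv_0_lt_compat |].
  rewrite <- !moebius_gap_point_pair by auto.
  generalize (Cmod_ge_0 (moebius (- f w) (f z))). nra.
Qed.

(** * Julia's lemma *)

Lemma angular_derivative_estimate (f : C -> C) (tau l : C) (M eps : R) :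
  angular_derivative f tau l -> 1 < M -> 0 < eps ->
  exists delta, 0 < delta /\ forall z, stolz_region tau M z -> Cmod (z - tau) < delta ->
    Cmod ((f z - tau) / (z - tau) - l) < eps.
Proof.
  intros H HM Heps.
  destruct (Cmod_locally_C _ _ (H M HM _ (locally_C_Cmod l eps Heps))) as (delta & Hdelta & Hq).
  exists delta. split; [exact Hdelta |]. intros z Hz Hzt. exact (Hq z Hzt Hz).
Qed.

Lemma unit_conj_mult (tau : C) : Cmod tau = 1 -> (Cconj tau * tau = 1)%C.
Proof.
  intros H. rewrite Cmult_comm, <- Cmod2_conj, H. apply injective_projections; simpl; ring.
Qed.

Lemma Cmod_unit_conj (tau v : C) : Cmod tau = 1 -> Cmod (1 - Cconj tau * v) = Cmod (v - tau).
Proof.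
  intros H. rewrite <- (unit_conj_mult tau H).
  replace (Cconj tau * tau - Cconj tau * v)%C with (Cconj tau * (tau - v))%C by ring.
  rewrite Cmod_mult, Cmod_conj, H, Cmod_minus_sym. ring.
Qed.

Lemma boundary_dist_pos (tau z : C) : Cmod tau = 1 -> unit_disc z -> 0 < Cmod (z - tau).
Proof.
  intros Ht Hz. apply Cmod_gt_0. intros E. apply Ceq_minus in E. subst.
  unfold unit_disc in Hz. lra.
Qed.

(** In the coordinate [s = 1 - conj tau z] the disc is [|1 - s| < 1], so its
    gap function is [2 Re s - |s|^2]. *)
Lemma gap_near_boundary (tau z : C) : Cmod tau = 1 ->
  1 - Cmod z ^ 2 = 2 * Re (1 - Cconj tau * z)%C - Cmod (z - tau) ^ 2.
Proof.
  intros Ht. rewrite <- (Cmod_unit_conj tau z Ht).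
  assert (E : Cmod z ^ 2 = Cmod (Cconj tau * z) ^ 2).
  { rewrite Cmod_mult, Cmod_conj, Ht. ring. }
  rewrite E, !Cmod2_alt. unfold Re, Im. simpl. ring.
Qed.

Lemma is_lim_seq_Cmod (u : nat -> C) (l : C) (k : R) (e : nat -> R) :
  (forall n, Cmod (u n - l) <= k * e n) -> is_lim_seq e 0 ->
  is_lim_seq (fun n => Cmod (u n)) (Cmod l).
Proof.
  intros H He.
  assert (Hk : is_lim_seq (fun n => k * e n) 0).
  { replace (Finite 0) with (Rbar_mult k 0) by (simpl; f_equal; ring).
    now apply is_lim_seq_scal_l. }
  apply (is_lim_seq_le_le (fun n => Cmod l - k * e n) _ (fun n => Cmod l + k * e n)).
  - intros n. specialize (H n).
    assert (T1 := Cmod_triangle (u n) (l - u n)). assert (T2 := Cmod_triangle l (u n - l)).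
    replace (u n + (l - u n))%C with l in T1 by ring.
    replace (l + (u n - l))%C with (u n) in T2 by ring.
    rewrite (Cmod_minus_sym l) in T1. lra.
  - replace (Cmod l) with (Cmod l - 0) at 1 by ring.
    apply (is_lim_seq_minus' _ _ (Cmod l) 0); [apply is_lim_seq_const | exact Hk].
  - replace (Cmod l) with (Cmod l + 0) at 1 by ring.
    apply (is_lim_seq_plus' _ _ (Cmod l) 0); [apply is_lim_seq_const | exact Hk].
Qed.

(** With [q] the difference quotient at [r tau], one has
    [1 - conj tau * f (r tau) = (1 - r) q]; the estimate is
    [gap_near_boundary] with the negative term dropped. *)
Lemma radial_gap_quotient (f : C -> C) (tau : C) (b r : R) :
  Cmod tau = 1 -> 0 < b -> 0 < r < 1 ->
  Re ((f (r * tau)%C - tau) / (r * tau - tau))%C <= b ->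
  1 - Cmod (f (r * tau)%C) ^ 2 <= 2 * b * (1 - r).
Proof.
  intros Ht Hb Hr Hq.
  assert (Hne : (r * tau - tau)%C <> 0).
  { apply Cmod_gt_0. replace (r * tau - tau)%C with (RtoC (r - 1) * tau)%C
      by (rewrite RtoC_minus; ring).
    rewrite Cmod_mult, Ht, Cmod_R. rewrite Rabs_left; lra. }
  set (q := ((f (r * tau)%C - tau) / (r * tau - tau))%C) in *.
  set (u := f (r * tau)%C) in *.
  assert (Eu : (1 - Cconj tau * u)%C = (RtoC (1 - r) * q)%C).
  { assert (E : u = (tau + q * (r * tau - tau))%C) by (unfold q; field; exact Hne).
    rewrite E, RtoC_minus.
    replace (Cconj tau * (tau + q * (r * tau - tau)))%C
      with ((Cconj tau * tau) * (1 + q * (r - 1)))%C by ring.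
    rewrite unit_conj_mult by exact Ht. ring. }
  rewrite (gap_near_boundary tau u Ht), Eu, re_scal_l.
  generalize (pow2_ge_0 (Cmod (u - tau))). nra.
Qed.

(** Schwarz-Pick for the pair [z], [(1 - t) tau] compares the two sides up to
    the factor [(1 - |f ((1 - t) tau)|^2) / (1 - (1 - t)^2)], which
    [radial_gap_quotient] bounds by [2 b / (2 - t)]. Let [t] tend to 0. *)
Lemma julia_lemma (f : C -> C) (tau : C) (a b : R) (z : C) :
  (forall z, unit_disc z -> C_differentiable_at f z) ->
  self_map f ->
  Cmod tau = 1 -> angular_derivative f tau a -> a < b -> 0 < b -> unit_disc z ->
  Cmod (f z - tau) ^ 2 / (1 - Cmod (f z) ^ 2) <= b * (Cmod (z - tau) ^ 2 / (1 - Cmod z ^ 2)).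
Proof.
  intros Hf HD Ht Ha Hab Hb Hz.
  destruct (angular_derivative_estimate f tau a 2 (b - a) Ha ltac:(lra) ltac:(lra))
    as (d & Hd & Hq).
  (* Distances to [tau] along the radius, all below [d] and 1. *)
  pose (t := fun n : nat => Rmin d 1 / 2 * (/ 2) ^ n).
  assert (Hm : 0 < Rmin d 1) by (apply Rmin_pos; lra).
  assert (Hlim : is_lim_seq t 0).
  { replace (Finite 0) with (Rbar_mult (Rmin d 1 / 2) 0) by (simpl; f_equal; ring).
    apply is_lim_seq_scal_l, is_lim_seq_geom. rewrite Rabs_pos_eq; lra. }
  assert (Htn : forall n, 0 < t n /\ t n < d /\ t n < 1).
  { intros n. assert (0 < (/ 2) ^ n <= 1).
    { split; [apply pow_lt; lra |]. rewrite <- (pow1 n). apply pow_incr. lra. }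
    assert (L1 := Rmin_l d 1). assert (L2 := Rmin_r d 1).
    assert (0 < t n) by (unfold t; nra).
    assert (t n <= Rmin d 1 / 2) by (unfold t; nra). lra. }
  pose (w := fun n => (RtoC (1 - t n) * tau)%C).
  assert (Hwt : forall n, Cmod (w n - tau) = t n).
  { intros n. unfold w. replace (RtoC (1 - t n) * tau - tau)%C with (- (t n * tau))%C
      by (rewrite RtoC_minus; ring).
    rewrite Cmod_opp, Cmod_mult, Cmod_R, Ht, Rabs_pos_eq; [ring | left; apply Htn]. }
  assert (Hwm : forall n, Cmod (w n) = 1 - t n).
  { intros n. unfold w. rewrite Cmod_mult, Cmod_R, Ht, Rabs_pos_eq; [ring |].
    generalize (Htn n). lra. }
  assert (HwD : forall n, unit_disc (w n)).
  { intros n. unfold unit_disc. rewrite Hwm. generalize (Htn n). lra. }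
  assert (Hquot : forall n, Cmod ((f (w n) - tau) / (w n - tau) - a) < b - a).
  { intros n. apply Hq.
    - split; [apply HwD |]. rewrite Hwt, Hwm. generalize (Htn n). lra.
    - rewrite Hwt. apply Htn. }
  assert (Hne : forall n, (w n - tau)%C <> 0).
  { intros n. apply Cmod_gt_0. rewrite Hwt. apply Htn. }
  assert (Hgap : forall n, 1 - Cmod (f (w n)) ^ 2 <= 2 * b * t n).
  { intros n. replace (t n) with (1 - (1 - t n)) by ring.
    apply radial_gap_quotient; auto.
    - generalize (Htn n). lra.
    - fold (w n). generalize (Hquot n).
      set (q := ((f (w n) - tau) / (w n - tau))%C). intros B.
      assert (B' := Rle_lt_trans _ _ _ (re_le_Cmod _) B).
      apply Rabs_lt_between in B'.
      assert (Re (q - a)%C = Re q - a) by (unfold Re; simpl; ring). lra. }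
  assert (Hft : forall n, Cmod (f (w n) - tau) <= (Rabs a + (b - a)) * t n).
  { intros n.
    replace (f (w n) - tau)%C with ((f (w n) - tau) / (w n - tau) * (w n - tau))%C
      by (field; apply Hne).
    rewrite Cmod_mult, Hwt. apply Rmult_le_compat_r; [left; apply Htn |].
    generalize (Hquot n). set (q := ((f (w n) - tau) / (w n - tau))%C). intros B.
    replace q with (a + (q - a))%C by ring.
    eapply Rle_trans; [apply Cmod_triangle |]. rewrite Cmod_R. lra. }
  assert (Gz := disc_gap z Hz). assert (Gfz := disc_gap _ (HD z Hz)).
  assert (Hineq : forall n, Cmod (1 - Cconj (f (w n)) * f z) ^ 2 / (1 - Cmod (f z) ^ 2) * (2 - t n)
     <= 2 * b * (Cmod (1 - Cconj (w n) * z) ^ 2 / (1 - Cmod z ^ 2))).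
  { intros n. assert (SP := schwarz_pick f z (w n) Hf HD Hz (HwD n)). unfold point_pair in SP.
    assert (G := disc_gap _ (HD _ (HwD n))). specialize (Hgap n).
    destruct (Htn n) as (Ht0 & _ & Ht1). rewrite Hwm in SP.
    set (x := Cmod (1 - Cconj (f (w n)) * f z) ^ 2 / (1 - Cmod (f z) ^ 2)).
    set (y := Cmod (1 - Cconj (w n) * z) ^ 2 / (1 - Cmod z ^ 2)).
    set (g := 1 - Cmod (f (w n)) ^ 2) in *.
    assert (Hx : 0 <= x).
    { apply Rmult_le_pos; [apply pow2_ge_0 | left; now apply Rinv_0_lt_compat]. }
    assert (SP' : x / g <= y / (t n * (2 - t n))).
    { replace (x / g) with (Cmod (1 - Cconj (f (w n)) * f z) ^ 2 / ((1 - Cmod (f z) ^ 2) * g))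
        by (unfold x; field; lra).
      replace (y / (t n * (2 - t n))) with
        (Cmod (1 - Cconj (w n) * z) ^ 2 / ((1 - Cmod z ^ 2) * (1 - (1 - t n) ^ 2))); [exact SP |].
      unfold y. replace (1 - (1 - t n) ^ 2) with (t n * (2 - t n)) by ring. field. lra. }
    assert (Hpos : 0 < t n * (2 - t n)) by (apply Rmult_lt_0_compat; lra).
    apply (proj1 (Rle_div_l _ _ _ G)) in SP'.
    assert (Hy : 0 <= y).
    { apply Rmult_le_pos; [apply pow2_ge_0 | left; now apply Rinv_0_lt_compat]. }
    assert (Hyy : 0 <= y / (t n * (2 - t n))).
    { apply Rmult_le_pos; [exact Hy | left; now apply Rinv_0_lt_compat]. }
    assert (SP2 : x <= y / (t n * (2 - t n)) * (2 * b * t n)) by nra.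
    replace (y / (t n * (2 - t n)) * (2 * b * t n)) with (2 * b * y / (2 - t n)) in SP2
      by (field; lra).
    apply Rle_div_r in SP2; lra. }
  rewrite <- (Cmod_unit_conj tau (f z) Ht), <- (Cmod_unit_conj tau z Ht).
  set (Lf := Cmod (1 - Cconj tau * f z)). set (Lz := Cmod (1 - Cconj tau * z)).
  assert (Lim1 : is_lim_seq (fun n => Cmod (1 - Cconj (f (w n)) * f z)) Lf).
  { apply (is_lim_seq_Cmod _ _ (Rabs a + (b - a)) t); [| exact Hlim]. intros n.
    replace (1 - Cconj (f (w n)) * f z - (1 - Cconj tau * f z))%C
      with ((Cconj tau - Cconj (f (w n))) * f z)%C by ring.
    rewrite <- Cminus_conj, Cmod_mult, Cmod_conj, Cmod_minus_sym.
    eapply Rle_trans; [| apply Hft]. generalize (HD z Hz) (Cmod_ge_0 (f (w n) - tau)).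
    unfold unit_disc. nra. }
  assert (Lim2 : is_lim_seq (fun n => Cmod (1 - Cconj (w n) * z)) Lz).
  { apply (is_lim_seq_Cmod _ _ 1 t); [| exact Hlim]. intros n.
    replace (1 - Cconj (w n) * z - (1 - Cconj tau * z))%C
      with ((Cconj tau - Cconj (w n)) * z)%C by ring.
    rewrite <- Cminus_conj, Cmod_mult, Cmod_conj, Cmod_minus_sym, Hwt.
    generalize Hz (Htn n). unfold unit_disc. nra. }
  assert (Lim3 : is_lim_seq (fun n => 2 - t n) 2).
  { replace 2 with (2 - 0) at 1 by ring.
    apply (is_lim_seq_minus' _ _ 2 0); [apply is_lim_seq_const | exact Hlim]. }
  assert (Lim : Rbar_le (Lf * (Lf * 1) / (1 - Cmod (f z) ^ 2) * 2)
                        (2 * b * (Lz * (Lz * 1) / (1 - Cmod z ^ 2)))).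
  { eapply is_lim_seq_le; [exact Hineq | |].
    - apply (is_lim_seq_mult' _ _ (Lf * (Lf * 1) / (1 - Cmod (f z) ^ 2)) 2); [| exact Lim3].
      apply (is_lim_seq_scal_r _ _ (Lf * (Lf * 1))).
      apply is_lim_seq_mult'; [exact Lim1 |].
      apply is_lim_seq_mult'; [exact Lim1 | apply is_lim_seq_const].
    - apply (is_lim_seq_scal_l _ (2 * b) (Lz * (Lz * 1) / (1 - Cmod z ^ 2))).
      apply (is_lim_seq_scal_r _ _ (Lz * (Lz * 1))).
      apply is_lim_seq_mult'; [exact Lim2 |].
      apply is_lim_seq_mult'; [exact Lim2 | apply is_lim_seq_const]. }
  simpl in Lim |- *. lra.
Qed.

(** * Orbits of hyperbolic maps *)

(** The real part of [(tau + z) / (tau - z)], that is, the height of [z] in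
    the half-plane model of the disc with [tau] at infinity. *)
Definition poisson_kernel (tau z : C) : R := (1 - Cmod z ^ 2) / Cmod (z - tau) ^ 2.

Lemma poisson_kernel_pos (tau z : C) :
  Cmod tau = 1 -> unit_disc z -> 0 < poisson_kernel tau z.
Proof.
  intros Ht Hz. apply Rdiv_lt_0_compat; [now apply disc_gap |].
  apply pow_lt. now apply boundary_dist_pos.
Qed.

Lemma boundary_dist_le (tau z : C) : Cmod tau = 1 -> unit_disc z ->
  Cmod (z - tau) * poisson_kernel tau z <= 2.
Proof.
  intros Ht Hz. assert (Hd := boundary_dist_pos tau z Ht Hz).
  unfold poisson_kernel.
  replace (Cmod (z - tau) * ((1 - Cmod z ^ 2) / Cmod (z - tau) ^ 2))
    with ((1 - Cmod z ^ 2) / Cmod (z - tau)) by (field; lra).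
  apply Rle_div_l; [exact Hd |].
  assert (T := Cmod_triangle z (tau - z)). replace (z + (tau - z))%C with tau in T by ring.
  rewrite Ht, Cmod_minus_sym in T. unfold unit_disc in Hz. generalize (Cmod_ge_0 z). nra.
Qed.

(** A bounded hyperbolic step moves a point of the half-plane model by at most
    a constant times the geometric mean of the two heights, hence by a constant
    times the larger one. Up to an affine change of variable the half-plane
    coordinate is [1 / (z - tau)]. *)
Lemma inverse_displacement (tau z z' : C) (K b : R) :
  Cmod tau = 1 -> unit_disc z -> unit_disc z' ->
  point_pair z' z <= K -> 0 <= b <= 1 ->
  poisson_kernel tau z <= b * poisson_kernel tau z' ->
  / Cmod (z' - tau) <= / Cmod (z - tau) + (K + 1) * poisson_kernel tau z'.
Proof.
  intros Ht Hz Hz' HK Hb HH.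
  assert (Hd := boundary_dist_pos tau z Ht Hz). assert (Hd' := boundary_dist_pos tau z' Ht Hz').
  assert (G := disc_gap z Hz). assert (G' := disc_gap z' Hz').
  assert (HP := poisson_kernel_pos tau z Ht Hz).
  assert (HP' := poisson_kernel_pos tau z' Ht Hz').
  assert (HK0 : 0 <= K) by (generalize (point_pair_pos z' z Hz' Hz); lra).
  assert (N := moebius_numerator_gap (- z) z').
  rewrite Copp_conj, Cmod_opp in N.
  replace (1 + - Cconj z * z')%C with (1 - Cconj z * z')%C in N by ring.
  change (z' + - z)%C with (z' - z)%C in N.
  unfold point_pair in HK.
  apply Rle_div_l in HK; [| now apply Rmult_lt_0_compat].
  set (H := poisson_kernel tau z) in *.
  set (H' := poisson_kernel tau z') in *.
  set (x := Cmod (z - tau)) in *. set (x' := Cmod (z' - tau)) in *.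
  assert (EG : 1 - Cmod z ^ 2 = H * x ^ 2) by (unfold H, poisson_kernel; fold x; field; lra).
  assert (EG' : 1 - Cmod z' ^ 2 = H' * x' ^ 2) by (unfold H', poisson_kernel; fold x'; field; lra).
  rewrite EG, EG' in HK, N.
  assert (S : Cmod (z' - z) ^ 2 <= ((K + 1) * H' * (x * x')) ^ 2).
  { assert (0 < H' * x' ^ 2 * (H * x ^ 2)) by (rewrite <- EG, <- EG'; nra).
    apply Rle_trans with (K * (H * H') * (x * x') ^ 2); [nra |].
    replace (((K + 1) * H' * (x * x')) ^ 2) with ((K + 1) ^ 2 * (H' * H') * (x * x') ^ 2) by ring.
    apply Rmult_le_compat_r; [apply pow2_ge_0 |].
    apply Rmult_le_compat; [assumption | nra | nra |].
    apply Rmult_le_compat_r; nra. }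
  assert (S' : Cmod (z' - z) <= (K + 1) * H' * (x * x')).
  { apply Rsqr_incr_0_var; [rewrite !Rsqr_pow2; exact S |].
    apply Rmult_le_pos; apply Rmult_le_pos; lra. }
  assert (T : x <= x' + Cmod (z' - z)).
  { unfold x, x'. rewrite (Cmod_minus_sym z' z).
    replace (z - tau)%C with ((z' - tau) + (z - z'))%C by ring. apply Cmod_triangle. }
  apply Rmult_le_reg_r with (x * x'); [nra |].
  replace (/ x' * (x * x')) with x by (field; lra).
  replace ((/ x + (K + 1) * H') * (x * x')) with (x' + (K + 1) * H' * (x * x')) by (field; lra).
  lra.
Qed.

Lemma iterate_in_disc (f : C -> C) (z : C) (n : nat) :
  self_map f -> unit_disc z -> unit_disc (iterate f n z).
Proof. intros HD Hz. induction n as [| n IH]; [exact Hz | exact (HD _ IH)]. Qed.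

Lemma orbit_step_bounded (f : C -> C) (z : C) (n : nat) :
  (forall z, unit_disc z -> C_differentiable_at f z) -> self_map f -> unit_disc z ->
  point_pair (iterate f (S n) z) (iterate f n z) <= point_pair (f z) z.
Proof.
  intros Hf HD Hz. induction n as [| n IH]; [apply Rle_refl |].
  eapply Rle_trans; [| exact IH].
  apply (schwarz_pick f); auto using iterate_in_disc.
Qed.

(** The heights form a sequence growing at least geometrically and the steps
    are dominated by the heights, so the modulus of the half-plane coordinate is
    dominated by the current height. The conclusion is this domination
    multiplied by [|u n - tau|^2]. *)
Lemma orbit_nontangential (tau : C) (b K : R) (u : nat -> C) :
  Cmod tau = 1 -> (forall n, unit_disc (u n)) -> 0 <= b < 1 ->
  (forall n, poisson_kernel tau (u n) <= b * poisson_kernel tau (u (S n))) ->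
  (forall n, point_pair (u (S n)) (u n) <= K) ->
  exists c, 0 < c /\ forall n, Cmod (u n - tau) <= c * (1 - Cmod (u n) ^ 2).
Proof.
  intros Ht Hu Hb HH HK.
  set (H := fun n => poisson_kernel tau (u n)) in *.
  assert (Hpos : forall n, 0 < H n) by (intros n; now apply poisson_kernel_pos).
  assert (Hd : forall n, 0 < Cmod (u n - tau)) by (intros n; now apply boundary_dist_pos).
  assert (HK0 : 0 < K) by (generalize (point_pair_pos _ _ (Hu 1%nat) (Hu 0%nat)) (HK 0%nat); lra).
  (* The first summand starts the induction; the second one absorbs the
     step, as [c b + (K + 1) <= c]. *)
  pose (c := / Cmod (u 0%nat - tau) / H 0%nat + (K + 1) / (1 - b)).
  assert (Hc1 : 0 < / Cmod (u 0%nat - tau) / H 0%nat).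
  { apply Rdiv_lt_0_compat; [now apply Rinv_0_lt_compat | apply Hpos]. }
  assert (Hc2 : 0 < (K + 1) / (1 - b)) by (apply Rdiv_lt_0_compat; lra).
  assert (Hcb : K + 1 <= c * (1 - b)).
  { unfold c. rewrite Rmult_plus_distr_r.
    replace ((K + 1) / (1 - b) * (1 - b)) with (K + 1) by (field; lra). nra. }
  assert (Hc : 0 < c) by (unfold c; lra).
  assert (Hinv : forall n, / Cmod (u n - tau) <= c * H n).
  { induction n as [| n IH].
    - replace (/ Cmod (u 0%nat - tau)) with (/ Cmod (u 0%nat - tau) / H 0%nat * H 0%nat)
        by (field; split; apply Rgt_not_eq; [apply Hd | apply Hpos]).
      apply Rmult_le_compat_r; [left; apply Hpos | unfold c; lra].
    - eapply Rle_trans.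
      + apply (inverse_displacement tau (u n) (u (S n)) K b); auto; lra.
      + change (poisson_kernel tau (u (S n))) with (H (S n)).
        specialize (HH n). generalize (Hpos (S n)). change (H n <= b * H (S n)) in HH.
        assert (c * H n <= c * (b * H (S n))) by (apply Rmult_le_compat_l; lra). nra. }
  exists c. split; [exact Hc |]. intros n. specialize (Hinv n). specialize (Hd n).
  unfold H, poisson_kernel in Hinv. set (x := Cmod (u n - tau)) in *.
  apply Rmult_le_reg_r with (/ x ^ 2); [apply Rinv_0_lt_compat, pow_lt; lra |].
  replace (x * / x ^ 2) with (/ x) by (field; lra). unfold Rdiv in Hinv. lra.
Qed.

Lemma orbit_converges (tau : C) (b : R) (u : nat -> C) :
  Cmod tau = 1 -> (forall n, unit_disc (u n)) -> 0 < b < 1 ->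
  (forall n, poisson_kernel tau (u n) <= b * poisson_kernel tau (u (S n))) ->
  is_lim_seq (fun n => Cmod (u n - tau)) 0.
Proof.
  intros Ht Hu Hb HH.
  assert (Hpos := fun n => poisson_kernel_pos tau _ Ht (Hu n)).
  assert (Hg : forall n, poisson_kernel tau (u 0%nat) <= b ^ n * poisson_kernel tau (u n)).
  { induction n as [| n IH]; [simpl; lra |].
    eapply Rle_trans; [exact IH |]. simpl. rewrite (Rmult_comm b), Rmult_assoc.
    apply Rmult_le_compat_l; [apply pow_le; lra | apply HH]. }
  apply (is_lim_seq_le_le (fun _ => 0) _ (fun n => 2 / poisson_kernel tau (u 0%nat) * b ^ n)).
  - intros n. split; [apply Cmod_ge_0 |].
    assert (B := boundary_dist_le tau _ Ht (Hu n)). specialize (Hg n).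
    assert (P0 := Hpos 0%nat). assert (Pn := Hpos n).
    assert (N := Cmod_ge_0 (u n - tau)).
    assert (Hbn : 0 < b ^ n) by (apply pow_lt; lra).
    replace (2 / poisson_kernel tau (u 0%nat) * b ^ n)
      with (2 * b ^ n / poisson_kernel tau (u 0%nat)) by (field; lra).
    apply Rle_div_r; [exact P0 |].
    apply Rle_trans with (Cmod (u n - tau) * (b ^ n * poisson_kernel tau (u n))).
    + now apply Rmult_le_compat_l.
    + nra.
  - apply is_lim_seq_const.
  - replace (Finite 0) with (Rbar_mult (2 / poisson_kernel tau (u 0%nat)) 0) by (simpl; f_equal; ring).
    apply is_lim_seq_scal_l, is_lim_seq_geom. rewrite Rabs_pos_eq; lra.
Qed.

(** In the coordinate [s = 1 - conj tau z] the step is multiplication by the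
    quotient [q]. Up to errors controlled by the nontangential bound the gap is
    [2 Re s], which is multiplied by about [a]. *)
Lemma gap_contraction (tau z z' : C) (a b c : R) :
  Cmod tau = 1 -> unit_disc z -> a <= b -> 0 <= b -> 0 < c ->
  Cmod (z - tau) <= c * (1 - Cmod z ^ 2) ->
  1 - Cmod z' ^ 2 <=
    (b * (1 + c * Cmod (z - tau)) + 2 * c * Cmod ((z' - tau) / (z - tau) - a))
      * (1 - Cmod z ^ 2).
Proof.
  intros Ht Hz Hab Hb Hc Hnt.
  assert (Hd := boundary_dist_pos tau z Ht Hz). assert (G := disc_gap z Hz).
  assert (Hne : (z - tau)%C <> 0) by now apply Cmod_gt_0.
  set (q := ((z' - tau) / (z - tau))%C).
  assert (E : (1 - Cconj tau * z')%C = (a * (1 - Cconj tau * z) + (q - a) * (1 - Cconj tau * z))%C).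
  { replace z' with (tau + q * (z - tau))%C by (unfold q; field; exact Hne).
    replace (1 - Cconj tau * (tau + q * (z - tau)))%C
      with (1 - Cconj tau * tau - q * (Cconj tau * z - Cconj tau * tau))%C by ring.
    rewrite unit_conj_mult by exact Ht. ring. }
  rewrite (gap_near_boundary tau z' Ht), E, re_plus, re_scal_l.
  assert (B : Re ((q - a) * (1 - Cconj tau * z))%C <= Cmod (q - a) * Cmod (z - tau)).
  { eapply Rle_trans; [apply Rle_abs |]. eapply Rle_trans; [apply re_le_Cmod |].
    rewrite Cmod_mult, Cmod_unit_conj by exact Ht. apply Rle_refl. }
  assert (E2 := gap_near_boundary tau z Ht).
  set (s := Re (1 - Cconj tau * z)%C) in *. set (g := 1 - Cmod z ^ 2) in *.
  set (x := Cmod (z - tau)) in *.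
  assert (Hs : 2 * s = g + x ^ 2) by lra.
  assert (A1 : 2 * (a * s) <= b * (g + x ^ 2)).
  { replace (2 * (a * s)) with (a * (g + x ^ 2)) by (rewrite <- Hs; ring).
    apply Rmult_le_compat_r; [nra | exact Hab]. }
  assert (A2 : x ^ 2 <= c * x * g) by nra.
  assert (A3 : Cmod (q - a) * x <= Cmod (q - a) * (c * g)).
  { apply Rmult_le_compat_l; [apply Cmod_ge_0 | exact Hnt]. }
  assert (A4 : b * (g + x ^ 2) <= b * (g + c * x * g)) by (apply Rmult_le_compat_l; lra).
  generalize (pow2_ge_0 (Cmod (z' - tau))). nra.
Qed.

(** The numerator of [point_pair (u n) w] converges to a positive limit while
    its denominator is contracted by a factor [kappa n] with limit [b < 1]. *)
Lemma point_pair_eventually_increasing (f : C -> C) (tau z w : C) (a : R) :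
  (forall z, unit_disc z -> C_differentiable_at f z) -> self_map f ->
  Cmod tau = 1 -> angular_derivative f tau a -> a < 1 ->
  unit_disc z -> unit_disc w ->
  exists N, forall n, (N <= n)%nat ->
    point_pair (iterate f n z) w < point_pair (iterate f (S n) z) w.
Proof.
  intros Hf HD Ht Ha Ha1 Hz Hw.
  (* Julia's lemma asks for a positive [b > a]; the contraction asks for [b < 1]. *)
  pose (b := (Rmax a 0 + 1) / 2).
  assert (Hm1 := Rmax_l a 0). assert (Hm2 := Rmax_r a 0).
  assert (Hm3 : Rmax a 0 < 1) by (apply Rmax_lub_lt; lra).
  assert (Hb : 0 < b < 1) by (unfold b; lra). assert (Hab : a < b) by (unfold b; lra).
  pose (u := fun n => iterate f n z).
  assert (Hu : forall n, unit_disc (u n)) by (intros n; now apply iterate_in_disc).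
  assert (HH : forall n, poisson_kernel tau (u n)
      <= b * poisson_kernel tau (u (S n))).
  { intros n. assert (J := julia_lemma f tau a b (u n) Hf HD Ht Ha Hab (proj1 Hb) (Hu n)).
    change (f (u n)) with (u (S n)) in J.
    assert (I : forall v, poisson_kernel tau v = / (Cmod (v - tau) ^ 2 / (1 - Cmod v ^ 2))).
    { intros v. unfold poisson_kernel. now rewrite Rinv_div. }
    assert (D : forall k, 0 < Cmod (u k - tau) ^ 2 / (1 - Cmod (u k) ^ 2)).
    { intros k. apply Rdiv_lt_0_compat; [| now apply disc_gap].
      apply pow_lt. now apply boundary_dist_pos. }
    rewrite !I. assert (Dn := D n). assert (Dn' := D (S n)).
    apply Rinv_le_contravar in J; [| exact Dn'].
    rewrite Rinv_mult in J.
    apply Rmult_le_reg_l with (/ b); [apply Rinv_0_lt_compat; lra |].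
    rewrite <- (Rmult_assoc (/ b) b), Rinv_l, Rmult_1_l by lra. exact J. }
  destruct (orbit_nontangential tau b (point_pair (f z) z) u Ht Hu ltac:(lra) HH) as (c & Hc & Hnt).
  { intros n. now apply orbit_step_bounded. }
  assert (Hx := orbit_converges tau b u Ht Hu Hb HH).
  pose (x := fun n => Cmod (u n - tau)).
  pose (p := fun n => Cmod ((u (S n) - tau) / (u n - tau) - a)).
  assert (Hp : is_lim_seq p 0).
  { apply is_lim_seq_spec. intros eps.
    destruct (angular_derivative_estimate f tau a (2 * c + 2) eps Ha ltac:(lra) (cond_pos eps))
      as (d & Hd & Hq).
    apply is_lim_seq_spec in Hx. destruct (Hx (mkposreal d Hd)) as [N HN].
    exists N. intros n Hn. specialize (HN n Hn). simpl in HN.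
    rewrite Rminus_0_r, Rabs_pos_eq in HN by apply Cmod_ge_0.
    rewrite Rminus_0_r, Rabs_pos_eq by apply Cmod_ge_0.
    apply Hq; [| exact HN]. split; [apply Hu |].
    specialize (Hnt n). assert (Hun := Hu n). unfold unit_disc in Hun.
    assert (0 < (1 - Cmod (u n)) * (c * (1 - Cmod (u n)) + 2)) by (apply Rmult_lt_0_compat; nra).
    nra. }
  pose (kappa := fun n => b * (1 + c * x n) + 2 * c * p n).
  assert (Hkappa : is_lim_seq kappa b).
  { replace b with (b * (1 + c * 0) + 2 * c * 0) at 1 by ring.
    apply is_lim_seq_plus'.
    - apply (is_lim_seq_scal_l _ b (1 + c * 0)).
      apply is_lim_seq_plus'; [apply is_lim_seq_const |].
      now apply (is_lim_seq_scal_l _ c 0).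
    - now apply (is_lim_seq_scal_l _ (2 * c) 0). }
  pose (L := fun n => Cmod (1 - Cconj w * u n)).
  set (l := Cmod (1 - Cconj w * tau)).
  assert (HL : is_lim_seq L l).
  { apply (is_lim_seq_Cmod _ _ 1 x); [| exact Hx]. intros n.
    replace (1 - Cconj w * u n - (1 - Cconj w * tau))%C with (Cconj w * (tau - u n))%C by ring.
    rewrite Cmod_mult, Cmod_conj, Cmod_minus_sym. fold (x n).
    apply Rmult_le_compat_r; [apply Cmod_ge_0 | left; exact Hw]. }
  assert (Hl : 0 < l).
  { unfold l. generalize (Cmod_triangle (1 - Cconj w * tau) (Cconj w * tau)).
    replace (1 - Cconj w * tau + Cconj w * tau)%C with (RtoC 1) by ring.
    rewrite Cmod_1, Cmod_mult, Cmod_conj, Ht. unfold unit_disc in Hw. lra. }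
  assert (Hdiff : is_lim_seq (fun n => L (S n) ^ 2 - kappa n * L n ^ 2) (l * (l * 1) - b * (l * (l * 1)))).
  { assert (HL2 : is_lim_seq (fun n => L n ^ 2) (l * (l * 1))).
    { apply is_lim_seq_mult'; [exact HL |]. apply is_lim_seq_mult'; [exact HL | apply is_lim_seq_const]. }
    apply is_lim_seq_minus'.
    - now apply (is_lim_seq_incr_1 (fun n => L n ^ 2)).
    - now apply is_lim_seq_mult'. }
  assert (Hlim : 0 < l * (l * 1) - b * (l * (l * 1))).
  { replace (l * (l * 1) - b * (l * (l * 1))) with ((1 - b) * (l * l)) by ring.
    apply Rmult_lt_0_compat; [lra | now apply Rmult_lt_0_compat]. }
  apply is_lim_seq_spec in Hdiff. destruct (Hdiff (mkposreal _ Hlim)) as [N HN].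
  exists N. intros n Hn. specialize (HN n Hn). simpl in HN. apply Rabs_lt_between in HN.
  change (point_pair (u n) w < point_pair (u (S n)) w). unfold point_pair.
  assert (GC := gap_contraction tau (u n) (u (S n)) a b c Ht (Hu n) ltac:(lra) ltac:(lra) Hc (Hnt n)).
  fold (x n) (p n) (kappa n) in GC. fold (L n) (L (S n)).
  assert (G := disc_gap _ (Hu n)). assert (G' := disc_gap _ (Hu (S n))). assert (Gw := disc_gap w Hw).
  set (g := 1 - Cmod (u n) ^ 2) in *. set (g' := 1 - Cmod (u (S n)) ^ 2) in *.
  set (gw := 1 - Cmod w ^ 2) in *.
  replace (L n ^ 2 / (g * gw)) with (L n ^ 2 * g' * / (g * g' * gw)) by (field; lra).
  replace (L (S n) ^ 2 / (g' * gw)) with (L (S n) ^ 2 * g * / (g * g' * gw)) by (field; lra).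
  apply Rmult_lt_compat_r.
  - apply Rinv_0_lt_compat. repeat apply Rmult_lt_0_compat; assumption.
  - assert (0 <= L n ^ 2) by apply pow2_ge_0.
    apply Rle_lt_trans with (L n ^ 2 * (kappa n * g)); [now apply Rmult_le_compat_l |].
    simpl in *. nra.
Qed.

(** * Differentiation along curves *)

Definition artanh (x : R) : R := ln ((1 + x) / (1 - x)) / 2.

Lemma artanh_0 : artanh 0 = 0.
Proof. unfold artanh. replace ((1 + 0) / (1 - 0)) with 1 by field. rewrite ln_1. field. Qed.

Lemma is_derive_artanh (x : R) : -1 < x < 1 -> is_derive artanh x (/ (1 - x ^ 2)).
Proof.
  intros Hx. unfold artanh. auto_derive.
  - split; [lra |]. split; [| exact I]. apply Rdiv_lt_0_compat; lra.
  - field. repeat split; try lra; nra.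
Qed.

Lemma artanh_increasing (x y : R) : 0 <= x -> x < y -> y < 1 -> artanh x < artanh y.
Proof.
  intros Hx Hxy Hy. unfold artanh.
  assert (ln ((1 + x) / (1 - x)) < ln ((1 + y) / (1 - y))); [| lra].
  apply ln_increasing; [apply Rdiv_lt_0_compat; lra |].
  apply Rmult_lt_reg_r with ((1 - x) * (1 - y)); [apply Rmult_lt_0_compat; lra |].
  replace ((1 + x) / (1 - x) * ((1 - x) * (1 - y))) with ((1 + x) * (1 - y)) by (field; lra).
  replace ((1 + y) / (1 - y) * ((1 - x) * (1 - y))) with ((1 + y) * (1 - x)) by (field; lra).
  nra.
Qed.

(** Composing with the retraction onto [a, b] replaces one-sided continuity at
    the endpoints by continuity on the whole line. *)
Definition clamp (a b t : R) : R := Rmax a (Rmin t b).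

Lemma clamp_bounds (a b t : R) : a <= b -> a <= clamp a b t <= b.
Proof.
  intros H. unfold clamp. split; [apply Rmax_l |]. apply Rmax_lub; [exact H | apply Rmin_r].
Qed.

Lemma clamp_id (a b t : R) : a <= t <= b -> clamp a b t = t.
Proof. intros H. unfold clamp. rewrite Rmin_left, Rmax_right; lra. Qed.

Lemma clamp_lipschitz (a b s t : R) : a <= b -> Rabs (clamp a b s - clamp a b t) <= Rabs (s - t).
Proof.
  intros H. unfold clamp, Rmax, Rmin.
  repeat destruct Rle_dec; unfold Rabs; repeat destruct Rcase_abs; lra.
Qed.

Lemma continuous_clamp {U : UniformSpace} (u : R -> U) (a b t : R) :
  a <= b -> continuous_on (fun s => a <= s <= b) u ->
  continuous (fun s => u (clamp a b s)) t.
Proof.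
  intros Hab Hu.
  apply (filterlim_comp _ _ _ (clamp a b) u (locally t)
    (within (fun s => a <= s <= b) (locally (clamp a b t)))).
  - intros P [d Hd]. exists d. intros s Hs. apply Hd; [| now apply clamp_bounds].
    change (Rabs (clamp a b s - clamp a b t) < d).
    eapply Rle_lt_trans; [now apply clamp_lipschitz | exact Hs].
  - apply Hu. now apply clamp_bounds.
Qed.

(** The integrand [s] is controlled only in the open interval. It agrees there
    with the continuous [g], whose primitive can be compared with [h] by the
    mean value theorem. *)
Lemma increment_le_RInt (h s g : R -> R) (a b : R) :
  a < b -> (forall t, continuous h t) -> (forall t, continuous g t) ->
  (forall t, a < t < b -> s t = g t) ->
  (forall t, a < t < b -> exists l, is_derive h t l /\ l <= g t) ->
  h b - h a <= RInt s a b.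
Proof.
  intros Hab Hh Hg Es Hd.
  rewrite (RInt_ext s g) by (rewrite Rmin_left, Rmax_right by lra; exact Es).
  set (G := fun t => RInt g a t).
  assert (HG : forall t, is_derive G t (g t)).
  { intros t. apply (is_derive_RInt (V := R_NormedModule) g G a t).
    - exists (mkposreal 1 Rlt_0_1). intros y _.
      apply (RInt_correct (V := R_CompleteNormedModule)).
      apply (ex_RInt_continuous (V := R_CompleteNormedModule)). intros; apply Hg.
    - apply Hg. }
  assert (HD : forall t, a < t < b -> is_derive (fun t => h t - G t) t (Derive h t - g t)).
  { intros t Ht. destruct (Hd t Ht) as (l & Hl & _). rewrite (is_derive_unique _ _ _ Hl).
    now apply (is_derive_minus (V := R_NormedModule) h G). }
  (* The minimum with 0 gives the right sign also at the endpoints, where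
     the mean value theorem may place its intermediate point. *)
  destruct (MVT_gen (fun t => h t - G t) a b (fun t => Rmin 0 (Derive h t - g t))) as (c & Hc & E).
  - rewrite Rmin_left, Rmax_right by lra. intros t Ht.
    destruct (Hd t Ht) as (l & Hl & Hle).
    rewrite Rmin_right by (rewrite (is_derive_unique _ _ _ Hl); lra). now apply HD.
  - intros t _. apply continuity_pt_minus.
    + apply continuity_pt_filterlim, Hh.
    + apply continuity_pt_filterlim.
      apply (ex_derive_continuous (K := R_AbsRing) (V := R_NormedModule)). eexists; apply HG.
  - assert (G a = 0) by (unfold G; rewrite RInt_point; reflexivity).
    change (h b - h a <= G b). generalize (Rmin_l 0 (Derive h c - g c)). nra.
Qed.

Lemma is_derive_slope_comp (g q : C -> C) (d : R) (gamma : R -> C) (t : R) (v : C) :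
  0 < d -> C_continuous_at q (gamma t) ->
  (forall w, Cmod (w - gamma t) < d -> g w = (g (gamma t) + q w * (w - gamma t))%C) ->
  is_derive (fun s => Re (gamma s)) t (Re v) -> is_derive (fun s => Im (gamma s)) t (Im v) ->
  is_derive (fun s => Re (g (gamma s))) t (Re (q (gamma t) * v)%C) /\
  is_derive (fun s => Im (g (gamma s))) t (Im (q (gamma t) * v)%C).
Proof.
  intros Hd Hq E HX HY.
  assert (Eta : forall s, gamma s = (Re (gamma s), Im (gamma s))) by (intros s; apply surjective_pairing).
  rewrite (Eta t) in Hq, E.
  destruct (C_slope_real g q d _ _ Hd Hq E) as [HU HV]. rewrite <- Eta in HU, HV.
  apply is_derive_Reals in HX, HY.
  assert (DU := derivable_pt_lim_comp_2d _ (fun s => Re (gamma s)) (fun s => Im (gamma s)) t _ _ _ _ HU HX HY).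
  assert (DV := derivable_pt_lim_comp_2d _ (fun s => Re (gamma s)) (fun s => Im (gamma s)) t _ _ _ _ HV HX HY).
  apply is_derive_Reals in DU, DV. simpl in DU, DV. split.
  - apply (is_derive_ext (fun s => Re (g (Re (gamma s), Im (gamma s))))).
    { intros s. now rewrite <- Eta. }
    rewrite re_mult. replace (Re (q (gamma t)) * Re v - Im (q (gamma t)) * Im v)
      with (Re (q (gamma t)) * Re v + - Im (q (gamma t)) * Im v) by ring. exact DU.
  - apply (is_derive_ext (fun s => opp (- Im (g (Re (gamma s), Im (gamma s)))))).
    { intros s. rewrite <- Eta. unfold opp; simpl. ring. }
    rewrite im_mult. replace (Re (q (gamma t)) * Im v + Im (q (gamma t)) * Re v)
      with (opp (- Im (q (gamma t)) * Re v + - Re (q (gamma t)) * Im v)) by (unfold opp; simpl; ring).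
    now apply (is_derive_opp (V := R_NormedModule)).
Qed.

Lemma filterdiff_within_interior (gamma : R -> C) (a b t : R) (v : C) :
  a < t < b ->
  filterdiff (K := R_AbsRing) (U := R_NormedModule) (V := C_R_NormedModule)
    gamma (within (fun s => a <= s <= b) (locally t)) (fun h => scal h (v : C_R_NormedModule)) ->
  is_derive (fun s => Re (gamma s)) t (Re v) /\ is_derive (fun s => Im (gamma s)) t (Im v).
Proof.
  intros Ht [Hlin Hdom].
  assert (Hloc : filterdiff (K := R_AbsRing) (U := R_NormedModule) (V := C_R_NormedModule)
    gamma (locally t) (fun h => scal h (v : C_R_NormedModule))).
  { split; [exact Hlin |]. intros x Hx eps.
    apply (is_filter_lim_locally_unique (V := R_NormedModule)) in Hx. subst x.
    assert (Hw : is_filter_lim (within (fun s => a <= s <= b) (locally t)) t).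
    { intros P HP. now apply filter_le_within. }
    specialize (Hdom t Hw eps).
    assert (HI : locally t (fun s => a < s /\ s < b)).
    { apply filter_and; [apply open_gt | apply open_lt]; lra. }
    refine (filter_imp _ _ _ (filter_and _ _ HI Hdom)).
    intros s [Hs H]. apply H. lra. }
  split.
  - apply (filterdiff_ext_lin (K := R_AbsRing) (U := R_NormedModule) (V := R_NormedModule) _
      (fun h : R => fst (scal h (v : C_R_NormedModule)))); [| reflexivity].
    apply (filterdiff_comp' (V := C_R_NormedModule) gamma (fun z => fst z) t _ (fun z => fst z) Hloc).
    apply filterdiff_linear, is_linear_fst.
  - apply (filterdiff_ext_lin (K := R_AbsRing) (U := R_NormedModule) (V := R_NormedModule) _
      (fun h : R => snd (scal h (v : C_R_NormedModule)))); [| reflexivity].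
    apply (filterdiff_comp' (V := C_R_NormedModule) gamma (fun z => snd z) t _ (fun z => snd z) Hloc).
    apply filterdiff_linear, is_linear_snd.
Qed.

(** The case [t = a] or [t = b] needs an argument because [filterdiff] speaks
    of every limit point of the filter; the only one is [t]. *)
Lemma filterdiff_from_components (gamma : R -> C) (a b t : R) (v : C) :
  a <= t <= b ->
  is_derive (fun s => Re (gamma s)) t (Re v) -> is_derive (fun s => Im (gamma s)) t (Im v) ->
  filterdiff (K := R_AbsRing) (U := R_NormedModule) (V := C_R_NormedModule)
    gamma (within (fun s => a <= s <= b) (locally t)) (fun h => scal h (v : C_R_NormedModule)).
Proof.
  intros Ht HX HY.
  assert (H : filterdiff (K := R_AbsRing) (U := R_NormedModule) (V := C_R_NormedModule)
    (fun s => (Re (gamma s), Im (gamma s)) : C_R_NormedModule) (locally t)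
    (fun h => (scal h (Re v : R_NormedModule), scal h (Im v : R_NormedModule)) : C_R_NormedModule)).
  { apply (filterdiff_comp'_2 (T := R_NormedModule) (U := R_NormedModule) (V := R_NormedModule)
      (W := C_R_NormedModule) (fun s => Re (gamma s)) (fun s => Im (gamma s)) (fun x y => (x, y)) t
      _ _ (fun x y => (x, y)) HX HY).
    apply (filterdiff_ext (fun y : C_R_NormedModule => y)); [intros [? ?]; reflexivity |].
    apply (filterdiff_ext_lin _ (fun y : C_R_NormedModule => y)); [| intros [? ?]; reflexivity].
    apply filterdiff_id. }
  destruct H as [Hlin Hdom].
  split; [exact Hlin |]. intros x Hx.
  assert (E : x = t).
  { destruct (Req_dec x t) as [| Hne]; [assumption | exfalso].
    assert (He : 0 < Rabs (t - x)) by (apply Rabs_pos_lt; lra).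
    destruct (Hx (fun y => Rabs (y - x) < Rabs (t - x))) as [d Hd].
    - exists (mkposreal _ He). intros y Hy. exact Hy.
    - assert (Rabs (t - x) < Rabs (t - x)); [| lra].
      apply Hd; [apply ball_center | exact Ht]. }
  subst x. intros eps.
  specialize (Hdom t (fun P HP => HP) eps).
  apply filter_le_within. revert Hdom. apply filter_imp. intros s Hs.
  eapply Rle_trans; [| exact Hs].
  rewrite (surjective_pairing (gamma s)), (surjective_pairing (gamma t)). apply Rle_refl.
Qed.

(** * The hyperbolic distance *)

(** Slope function of [moebius a] at [z]; on the diagonal it is the
    derivative. *)
Definition moebius_slope (a z w : C) : C :=
  ((1 - Cconj a * a) / ((1 + Cconj a * z) * (1 + Cconj a * w)))%C.

Lemma moebius_slope_eq (a z w : C) : unit_disc a -> unit_disc z -> unit_disc w ->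
  moebius a w = (moebius a z + moebius_slope a z w * (w - z))%C.
Proof.
  intros Ha Hz Hw.
  assert (H1 := moebius_denominator_neq_0 a z Ha Hz).
  assert (H2 := moebius_denominator_neq_0 a w Ha Hw).
  unfold moebius, moebius_slope. field. auto.
Qed.

Lemma disc_neighbourhood (z w : C) : Cmod (w - z) < 1 - Cmod z -> unit_disc w.
Proof.
  intros H. unfold unit_disc. generalize (Cmod_triangle z (w - z)).
  replace (z + (w - z))%C with w by ring. lra.
Qed.

Lemma moebius_slope_continuous (a z : C) : unit_disc a -> unit_disc z ->
  C_continuous_at (moebius_slope a z) z.
Proof.
  intros Ha Hz. assert (H := moebius_denominator_neq_0 a z Ha Hz).
  apply C_continuous_mult; [apply C_continuous_const |].
  apply (C_continuous_comp Cinv (fun w => (1 + Cconj a * z) * (1 + Cconj a * w))%C).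
  - apply C_continuous_mult; [apply C_continuous_const |].
    apply C_continuous_plus; [apply C_continuous_const |].
    apply C_continuous_mult; [apply C_continuous_const | apply C_continuous_id].
  - apply C_continuous_inv. now apply Cmult_neq_0.
Qed.

Lemma moebius_derivative_continuous (a z : C) : unit_disc a -> unit_disc z ->
  C_continuous_at (fun w => moebius_slope a w w) z.
Proof.
  intros Ha Hz. assert (H := moebius_denominator_neq_0 a z Ha Hz).
  apply C_continuous_mult; [apply C_continuous_const |].
  apply (C_continuous_comp Cinv (fun w => (1 + Cconj a * w) * (1 + Cconj a * w))%C).
  - apply C_continuous_mult;
    (apply C_continuous_plus; [apply C_continuous_const |];
    apply C_continuous_mult; [apply C_continuous_const | apply C_continuous_id]).
  - apply C_continuous_inv. now apply Cmult_neq_0.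
Qed.

(** Disc automorphisms preserve the density [1 / (1 - |z|^2)]. *)
Lemma moebius_isometry (a z : C) : unit_disc a -> unit_disc z ->
  Cmod (moebius_slope a z z) = (1 - Cmod (moebius a z) ^ 2) / (1 - Cmod z ^ 2).
Proof.
  intros Ha Hz. assert (H := moebius_denominator_neq_0 a z Ha Hz).
  assert (Gz := disc_gap z Hz). assert (Ga := disc_gap a Ha).
  rewrite moebius_gap by assumption. unfold moebius_slope.
  rewrite Cmod_div, Cmod_mult by now apply Cmult_neq_0.
  replace (1 - Cconj a * a)%C with (RtoC (1 - Cmod a ^ 2)).
  2:{ rewrite RtoC_minus, Cmod2_conj. ring. }
  rewrite Cmod_R, Rabs_pos_eq by lra. apply Cmod_gt_0 in H. field. lra.
Qed.

Lemma unit_phase (v : C) : exists c, Cmod c = 1 /\ (c * v = Cmod v)%C.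
Proof.
  destruct (Ceq_dec v 0) as [-> | Hv].
  - exists 1. rewrite Cmod_1, Cmod_0. split; [reflexivity | ring].
  - assert (Hm : 0 < Cmod v) by now apply Cmod_gt_0.
    assert (Hm' : RtoC (Cmod v) <> 0) by (intros E; apply RtoC_inj in E; lra).
    exists (Cconj v / Cmod v)%C. split.
    + rewrite Cmod_div, Cmod_conj, Cmod_R, Rabs_pos_eq by (assumption || lra). field. lra.
    + replace (Cconj v / Cmod v * v)%C with (v * Cconj v / Cmod v)%C by (field; exact Hm').
      rewrite <- Cmod2_conj, RtoC_pow. field. exact Hm'.
Qed.

Lemma velocity_unique (gamma : R -> C) (t : R) (v : C) :
  is_derive (fun s => Re (gamma s)) t (Re v) -> is_derive (fun s => Im (gamma s)) t (Im v) ->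
  velocity gamma t = v.
Proof.
  intros DX DY. rewrite (surjective_pairing v).
  exact (f_equal2 pair (is_derive_unique _ _ _ DX) (is_derive_unique _ _ _ DY)).
Qed.

(** After the automorphism [moebius a] and a rotation by [c] the density is
    unchanged, and along a curve the function [artanh (Re z)] has derivative at
    most [|Re z'| / (1 - (Re z)^2)], which is at most the hyperbolic speed. The
    real part is used instead of the modulus because it is differentiable
    at 0. *)
Lemma artanh_along_piece (a c : C) (gamma : R -> C) (t0 t1 : R) :
  unit_disc a -> Cmod c = 1 -> t0 < t1 -> C1_on gamma t0 t1 ->
  (forall t, t0 <= t <= t1 -> unit_disc (gamma t)) ->
  artanh (Re (c * moebius a (gamma t1))%C) - artanh (Re (c * moebius a (gamma t0))%C)
    <= RInt (fun t => Cmod (velocity gamma t) / (1 - Cmod (gamma t) ^ 2)) t0 t1.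
Proof.
  intros Ha Hc H01 (gamma' & Hder & Hcont) HD.
  assert (Hgc : continuous_on (fun s => t0 <= s <= t1) gamma).
  { intros t Ht.
    apply (filterdiff_continuous_aux (K := R_AbsRing) (U := R_NormedModule) (V := C_R_NormedModule)).
    - eexists. apply (Hder t Ht).
    - intros P HP. now apply filter_le_within. }
  set (cl := clamp t0 t1).
  assert (Hcl : forall t, t0 <= cl t <= t1) by (intros t; apply clamp_bounds; lra).
  assert (HclD : forall t, unit_disc (gamma (cl t))) by (intros t; apply HD, Hcl).
  assert (HX : forall z, unit_disc z -> -1 < Re (c * moebius a z)%C < 1 /\
     Rabs (Re (c * moebius a z)%C) <= Cmod (moebius a z)).
  { intros z Hz. assert (B := re_le_Cmod (c * moebius a z)%C).
    rewrite Cmod_mult, Hc, Rmult_1_l in B. assert (M := moebius_in_disc a z Ha Hz).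
    unfold unit_disc in M. split; [apply Rabs_lt_between; lra | exact B]. }
  set (h := fun t => artanh (Re (c * moebius a (gamma (cl t)))%C)).
  set (g := fun t => Cmod (gamma' (cl t)) / (1 - Cmod (gamma (cl t)) ^ 2)).
  replace (artanh (Re (c * moebius a (gamma t1))%C)) with (h t1)
    by (unfold h, cl; rewrite clamp_id by lra; reflexivity).
  replace (artanh (Re (c * moebius a (gamma t0))%C)) with (h t0)
    by (unfold h, cl; rewrite clamp_id by lra; reflexivity).
  assert (Hgcl : forall t, continuous (fun s => gamma (cl s)) t)
    by (intros t; apply continuous_clamp; [lra | exact Hgc]).
  apply increment_le_RInt with g; [exact H01 | | | |].
  - intros t. unfold h.
    apply (continuous_comp (fun s => Re (c * moebius a (gamma (cl s)))%C) artanh).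
    + apply (continuous_comp (fun s => gamma (cl s)) (fun z => Re (c * moebius a z)%C)); [apply Hgcl |].
      apply (continuous_comp (U := C_UniformSpace) (V := C_UniformSpace)
        (fun z => (c * moebius a z)%C) (fun z => fst z)).
      * apply continuous_C_continuous, C_continuous_mult; [apply C_continuous_const |].
        apply C_differentiable_continuous. now apply moebius_differentiable.
      * rewrite (surjective_pairing (c * moebius a (gamma (cl t)))%C). apply continuous_fst.
    + apply (ex_derive_continuous (K := R_AbsRing) (V := R_NormedModule)).
      eexists. apply is_derive_artanh, HX, HclD.
  - intros t. unfold g, Rdiv. apply (continuous_mult (K := R_AbsRing)).
    + apply (continuous_comp (fun s => gamma' (cl s)) Cmod); [| apply continuous_Cmod].
      apply continuous_clamp; [lra | exact Hcont].
    + apply continuous_Rinv_comp.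
      * apply (continuous_minus (V := R_NormedModule) (fun _ => 1)); [apply continuous_const |].
        apply (continuous_comp (fun s => Cmod (gamma (cl s))) (fun x => x ^ 2)).
        -- apply (continuous_comp (fun s => gamma (cl s)) Cmod); [apply Hgcl | apply continuous_Cmod].
        -- apply (ex_derive_continuous (K := R_AbsRing) (V := R_NormedModule)). auto_derive. exact I.
      * generalize (disc_gap _ (HclD t)). lra.
  - intros t Ht.
    destruct (filterdiff_within_interior gamma t0 t1 t _ Ht (Hder t ltac:(lra))) as [DX DY].
    unfold g, cl. rewrite clamp_id by lra. now rewrite (velocity_unique _ _ _ DX DY).
  - intros t Ht.
    destruct (filterdiff_within_interior gamma t0 t1 t _ Ht (Hder t ltac:(lra))) as [DX DY].
    assert (Hz : unit_disc (gamma t)) by (apply HD; lra).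
    destruct (is_derive_slope_comp (fun z => c * moebius a z)%C
       (fun w => c * moebius_slope a (gamma t) w)%C (1 - Cmod (gamma t)) gamma t (gamma' t)) as [DR _].
    + unfold unit_disc in Hz. lra.
    + apply C_continuous_mult; [apply C_continuous_const | now apply moebius_slope_continuous].
    + intros w Hw. rewrite (moebius_slope_eq a (gamma t) w Ha Hz (disc_neighbourhood _ _ Hw)). ring.
    + exact DX.
    + exact DY.
    + destruct (HX _ Hz) as [HX1 HX2].
      assert (DA := is_derive_artanh _ HX1).
      assert (DC := is_derive_comp artanh (fun s => Re (c * moebius a (gamma s))%C) t _ _ DA DR).
      eexists. split.
      * apply (is_derive_ext_loc (fun s => artanh (Re (c * moebius a (gamma s))%C))); [| exact DC].
        assert (HI : locally t (fun s => t0 < s /\ s < t1)).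
        { apply filter_and; [apply open_gt | apply open_lt]; lra. }
        revert HI. apply filter_imp. intros s Hs. unfold h, cl. rewrite clamp_id by lra. reflexivity.
      * unfold g, cl. rewrite clamp_id by lra.
        change (Re (c * moebius_slope a (gamma t) (gamma t) * gamma' t)%C *
          / (1 - Re (c * moebius a (gamma t))%C ^ 2) <=
          Cmod (gamma' t) / (1 - Cmod (gamma t) ^ 2)).
        assert (Gz := disc_gap _ Hz). assert (GM := disc_gap _ (moebius_in_disc a _ Ha Hz)).
        assert (B : Re (c * moebius_slope a (gamma t) (gamma t) * gamma' t)%C <=
           (1 - Cmod (moebius a (gamma t)) ^ 2) / (1 - Cmod (gamma t) ^ 2) * Cmod (gamma' t)).
        { eapply Rle_trans; [apply Rle_abs |]. eapply Rle_trans; [apply re_le_Cmod |].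
          rewrite !Cmod_mult, Hc, Rmult_1_l, moebius_isometry by assumption. apply Rle_refl. }
        set (X := Re (c * moebius a (gamma t))%C) in *.
        assert (HXX : 1 - Cmod (moebius a (gamma t)) ^ 2 <= 1 - X ^ 2).
        { rewrite <- (pow2_abs X). generalize (Rabs_pos X). nra. }
        apply Rle_div_l; [lra |].
        eapply Rle_trans; [exact B |].
        assert (N : 0 <= Cmod (gamma' t) / (1 - Cmod (gamma t) ^ 2)).
        { apply Rmult_le_pos; [apply Cmod_ge_0 | left; now apply Rinv_0_lt_compat]. }
        replace ((1 - Cmod (moebius a (gamma t)) ^ 2) / (1 - Cmod (gamma t) ^ 2) * Cmod (gamma' t))
          with (Cmod (gamma' t) / (1 - Cmod (gamma t) ^ 2) * (1 - Cmod (moebius a (gamma t)) ^ 2))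
          by (field; lra).
        now apply Rmult_le_compat_l.
Qed.

Lemma partition_nondecreasing (t : nat -> R) (k i j : nat) :
  (forall i, (i <= k)%nat -> t i < t (S i)) -> (i <= j)%nat -> (j <= S k)%nat -> t i <= t j.
Proof.
  intros H Hij Hj. induction Hij as [| j Hij IH]; [lra |].
  generalize (H j ltac:(lia)) (IH ltac:(lia)). lra.
Qed.

(** Add up [artanh_along_piece] over the pieces, with the rotation chosen such
    that the image of [w] is real and nonnegative. *)
Lemma hyperbolic_length_lower_bound (z w : C) (L : R) :
  unit_disc z -> joining_length z w L -> artanh (Cmod (moebius (- z) w)) <= L.
Proof.
  intros Hz (a & b & gamma & Hab & (k & t & Ht0 & Htk & Hp) & HD & Ega & Egb & HL).
  destruct (unit_phase (moebius (- z) w)) as (c & Hc & Ec).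
  set (S := fun s => Cmod (velocity gamma s) / (1 - Cmod (gamma s) ^ 2)).
  set (h := fun s => artanh (Re (c * moebius (- z) (gamma s))%C)).
  assert (Hz' := unit_disc_opp z Hz).
  assert (Hmono : forall i j, (i <= j)%nat -> (j <= k + 1)%nat -> t i <= t j).
  { intros i j Hij Hj. apply (partition_nondecreasing t k); [| exact Hij | lia].
    intros n Hn. now apply Hp. }
  assert (Hex : ex_RInt S a b) by (exists L; exact HL).
  assert (Hin : forall i, (i <= k + 1)%nat -> a <= t i <= b).
  { intros i Hi. rewrite <- Ht0, <- Htk. split; apply Hmono; lia. }
  assert (Hexi : forall i, (i <= k + 1)%nat -> ex_RInt S a (t i)).
  { intros i Hi. apply (ex_RInt_Chasles_1 (V := R_CompleteNormedModule) S a (t i) b); auto. }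
  assert (Hsum : forall i, (i <= k + 1)%nat -> h (t i) - h a <= RInt S a (t i)).
  { induction i as [| i IH]; intros Hi.
    - rewrite Ht0, RInt_point. unfold zero; simpl. lra.
    - destruct (Hp i ltac:(lia)) as [Hlt HC].
      assert (Hi1 := Hin i ltac:(lia)). assert (Hi2 := Hin (Datatypes.S i) Hi).
      assert (P := artanh_along_piece (- z) c gamma _ _ Hz' Hc Hlt HC
        (fun s Hs => HD s ltac:(lra))).
      fold S in P. change (h (t (Datatypes.S i)) - h (t i) <= RInt S (t i) (t (Datatypes.S i))) in P.
      assert (Hex2 : ex_RInt S (t i) (t (Datatypes.S i))).
      { apply (ex_RInt_Chasles_2 (V := R_CompleteNormedModule) S a); [lra | now apply Hexi]. }
      assert (Ch := RInt_Chasles (V := R_CompleteNormedModule) S a (t i) (t (Datatypes.S i))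
        (Hexi i ltac:(lia)) Hex2).
      unfold plus in Ch; simpl in Ch. specialize (IH ltac:(lia)). lra. }
  specialize (Hsum (Datatypes.S k) ltac:(lia)). rewrite Htk in Hsum.
  rewrite (is_RInt_unique (V := R_CompleteNormedModule) S a b L HL) in Hsum.
  unfold h in Hsum. rewrite Ega, Egb, Ec, moebius_opp_self, Cmult_0_r in Hsum.
  change (Re (RtoC (Cmod (moebius (- z) w)))) with (Cmod (moebius (- z) w)) in Hsum.
  change (Re (RtoC 0)) with 0 in Hsum. rewrite artanh_0 in Hsum. lra.
Qed.

(** The image under the automorphism [moebius z] of the straight segment from 0
    to [moebius (- z) w]. *)
Lemma geodesic_joins (z w : C) :
  unit_disc z -> unit_disc w -> joining_length z w (artanh (Cmod (moebius (- z) w))).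
Proof.
  intros Hz Hw.
  set (T := moebius (- z) w).
  assert (HT : unit_disc T) by (apply moebius_in_disc; [now apply unit_disc_opp | exact Hw]).
  assert (HT0 := Cmod_ge_0 T). assert (HT1 : Cmod T < 1) by exact HT.
  assert (HsT : forall s, 0 <= s <= 1 -> unit_disc (s * T)).
  { intros s Hs. unfold unit_disc. rewrite Cmod_mult, Cmod_R, Rabs_pos_eq by lra. nra. }
  set (gamma := fun s : R => moebius z (s * T)).
  set (gamma' := fun s : R => (moebius_slope z (s * T) (s * T) * T)%C).
  assert (Hder : forall s, 0 <= s <= 1 ->
    is_derive (fun s => Re (gamma s)) s (Re (gamma' s)) /\
    is_derive (fun s => Im (gamma s)) s (Im (gamma' s))).
  { intros s Hs.
    apply (is_derive_slope_comp (moebius z) (moebius_slope z (s * T)) (1 - Cmod (s * T))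
      (fun s => (s * T)%C)).
    - generalize (HsT s Hs). unfold unit_disc. lra.
    - now apply moebius_slope_continuous; [| apply HsT].
    - intros v Hv. apply moebius_slope_eq; auto. exact (disc_neighbourhood _ _ Hv).
    - apply (is_derive_ext (fun s => s * Re T)); [intros; symmetry; apply re_scal_l |].
      generalize (Re T). intros x. auto_derive; [exact I | ring].
    - apply (is_derive_ext (fun s => s * Im T)); [intros; symmetry; apply im_scal_l |].
      generalize (Im T). intros x. auto_derive; [exact I | ring]. }
  exists 0, 1, gamma. split; [lra |]. split; [| split; [| split; [| split]]].
  - exists 0%nat, INR. split; [reflexivity |]. split; [reflexivity |].
    intros i Hi. replace i with 0%nat by lia. simpl. split; [lra |].
    exists gamma'. split.
    + intros s Hs. apply filterdiff_from_components; [exact Hs | |]; now apply Hder.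
    + intros s Hs P HP. apply (filter_le_within (F := locally s)). revert P HP.
      change (continuous gamma' s).
      apply (continuous_comp (V := C_UniformSpace) (W := C_UniformSpace) (fun s : R => (s * T)%C)
        (fun v => (moebius_slope z v v * T)%C)).
      * intros P HP. destruct (Cmod_locally_C _ _ HP) as (e & He & HeP).
        assert (Hd : 0 < e / (Cmod T + 1)) by (apply Rdiv_lt_0_compat; lra).
        exists (mkposreal _ Hd). intros y Hy. apply HeP.
        replace (y * T - s * T)%C with (RtoC (y - s) * T)%C by (rewrite RtoC_minus; ring).
        rewrite Cmod_mult, Cmod_R.
        assert (Hy' : Rabs (y - s) < e / (Cmod T + 1)) by exact Hy.
        apply Rlt_div_r in Hy'; [| lra]. generalize (Rabs_pos (y - s)). nra.
      * apply continuous_C_continuous, C_continuous_mult; [| apply C_continuous_const].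
        apply moebius_derivative_continuous; auto.
  - intros s Hs. apply moebius_in_disc; auto.
  - unfold gamma. rewrite Cmult_0_l. apply moebius_0.
  - unfold gamma. rewrite Cmult_1_l. now apply moebius_inverse.
  - unfold hyperbolic_length.
    apply (is_RInt_ext (fun s => Cmod T * / (1 - (s * Cmod T) ^ 2))).
    { rewrite Rmin_left, Rmax_right by lra. intros s Hs.
      destruct (Hder s ltac:(lra)) as [DX DY].
      rewrite (velocity_unique _ _ _ DX DY). unfold gamma', gamma.
      assert (Hs' := HsT s ltac:(lra)).
      assert (G := disc_gap _ Hs'). assert (G' := disc_gap _ (moebius_in_disc z _ Hz Hs')).
      rewrite Cmod_mult, moebius_isometry by assumption.
      replace (s * Cmod T) with (Cmod (s * T)) by (rewrite Cmod_mult, Cmod_R, Rabs_pos_eq; lra).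
      lazymatch goal with |- ?l = ?r => change (@eq R l r) end. field. lra. }
    replace (artanh (Cmod T)) with (minus (artanh (1 * Cmod T)) (artanh (0 * Cmod T))).
    2:{ rewrite Rmult_1_l, Rmult_0_l, artanh_0. unfold minus, plus, opp; simpl. ring. }
    assert (Hlt : forall s, 0 <= s <= 1 -> 0 <= s * Cmod T < 1) by (intros; nra).
    apply (is_RInt_derive (V := R_CompleteNormedModule) (fun s => artanh (s * Cmod T)));
      intros s; rewrite Rmin_left, Rmax_right by lra; intros Hs; specialize (Hlt s Hs).
    + apply (is_derive_comp artanh (fun s => s * Cmod T) s).
      * apply is_derive_artanh. lra.
      * generalize (Cmod T). intros x. auto_derive; [exact I | ring].
    + generalize (Cmod T) Hlt. intros x Hx. apply (ex_derive_continuous (K := R_AbsRing) (V := R_NormedModule)). auto_derive. nra.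
Qed.

Lemma hyperbolic_dist_artanh (z w : C) : unit_disc z -> unit_disc w ->
  hyperbolic_dist z w = artanh (Cmod (moebius (- z) w)).
Proof.
  intros Hz Hw. unfold hyperbolic_dist.
  rewrite (is_glb_Rbar_unique _ (artanh (Cmod (moebius (- z) w)))); [reflexivity |].
  split.
  - intros L HL. now apply hyperbolic_length_lower_bound.
  - intros b Hb. now apply Hb, geodesic_joins.
Qed.

Lemma hyperbolic_dist_lt (w z z' : C) : unit_disc w -> unit_disc z -> unit_disc z' ->
  point_pair z w < point_pair z' w -> hyperbolic_dist w z < hyperbolic_dist w z'.
Proof.
  intros Hw Hz Hz' H. rewrite !hyperbolic_dist_artanh by assumption.
  assert (P := point_pair_pos z w Hz Hw).
  apply Rinv_lt_contravar in H; [| apply Rmult_lt_0_compat; lra].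
  rewrite <- !moebius_gap_point_pair in H by assumption.
  assert (N := Cmod_ge_0 (moebius (- w) z)). assert (N' := Cmod_ge_0 (moebius (- w) z')).
  apply artanh_increasing; [exact N | nra |].
  apply moebius_in_disc; [now apply unit_disc_opp | assumption].
Qed.

Theorem corollary1p2 (f : C -> C) (tau : C)
  (hf : hyperbolic_map f) (htau : denjoy_wolff_point f tau)
  (z w : C) (hz : unit_disc z) (hw : unit_disc w) :
  eventually_strictly_increasing (fun n : nat => hyperbolic_dist w (iterate f n z)).
Proof.
  destruct hf as (Hf & _ & sigma & a & [Hs _] & Ha & Ha1).
  assert (HD : self_map f) by (intros v Hv; now apply Hf).
  destruct (point_pair_eventually_increasing f sigma z w a) as [N HN]; auto.
  { intros v Hv. now apply ex_derive_C_differentiable, Hf. }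
  exists N. intros m n Hm Hmn.
  induction Hmn as [| n Hmn IH].
  - apply hyperbolic_dist_lt; auto using iterate_in_disc.
  - eapply Rlt_trans; [exact IH |].
    apply hyperbolic_dist_lt; auto using iterate_in_disc. apply HN. lia.
Qed.
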